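(* Let $g_1,\ldots,g_m\in\mathbb R[x]_d$, $a_1,\ldots,a_m\in\mathbb R$, $d_1=\lceil d/2\rceil$, and assume the system $a_i\ge\langle g_i,z\rangle$ ($i=1,\ldots,m$), $z\in\mathscr R_d(K^\circ)$ is feasible. Let $R$ be generic in the interior of $\Sigma[x]_{2d_1}$. Then: (i) The problem $\min\langle R,z\rangle$ s.t. $a_i-\langle g_i,z\rangle\ge0$ ($i\in[m]$), $z\in\mathscr R_{2d_1}(K^\circ)$ has a unique minimizer $z^*$, and $z^*=\lambda_1[u_1]_{2d_1}+\cdots+\lambda_r[u_r]_{2d_1}$ with scalars $\lambda_1,\ldots,\lambda_r>0$, distinct points $u_1,\ldots,u_r\in K^\circ$, and $r\le m$. (ii) For $k\ge d_2:=\max\{d_1,d_c\}$, let $z^{(k)}$ be a minimizer of the semidefinite relaxation $$\min\ \langle R,z\rangle\ \text{ s.t. }\ a_i-\langle g_i,z\rangle\ge0\ (i\in[m]),\ L^{(k)}_{c_i^{hom}}[z]=0\ (i\in\mathcal E),\ L^{(k)}_{c_j^{hom}}[z]\succeq0\ (j\in\mathcal I),\ L^{(k)}_{x^Tx-1}[z]=0,\ M_k[z]\succeq0,\ z\in\mathbb R^{\mathbb N^n_{2k}}.$$ Then for each fixed $t\ge d_1$, the sequence $\{z^{(k)}|_{2t}\}_{k\ge d_2}$ is bounded and every accumulation point $z^{**}$ of it satisfies $z^{**}|_{2d_1}=z^*$.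
   Context: $c_i$ ($i\in\mathcal E\cup\mathcal I$) are real polynomials in $x\in\mathbb R^n$; for a polynomial $p$ of degree $e$, $p^{hom}(x)$ is its homogeneous part of degree $e$. $K^\circ=\{x\in\mathbb R^n: c_i^{hom}(x)=0\ (i\in\mathcal E),\ c_j^{hom}(x)\ge0\ (j\in\mathcal I),\ x^Tx=1\}$. $d_c=\max\{\lceil\deg(c_i)/2\rceil: i\in\mathcal E\cup\mathcal I\}$. $\mathbb N^n_t=\{\alpha:|\alpha|\le t\}$, $[u]_t=(u^\alpha)_{\alpha\in\mathbb N^n_t}$, $\langle p,y\rangle=\sum_\alpha p_\alpha y_\alpha$, and for $z\in\mathbb R^{\mathbb N^n_{2k}}$, $z|_{2t}=(z_\alpha)_{\alpha\in\mathbb N^n_{2t}}$. $\mathscr R_t(T)$ is the set of $y\in\mathbb R^{\mathbb N^n_t}$ admitting a Borel measure $\mu$ supported in $T$ with $y_\alpha=\int x^\alpha d\mu$ for $|\alpha|\le t$. For a polynomial $q=\sum q_\gamma x^\gamma$ with $\deg q\le 2k$, the localizing matrix $L^{(k)}_q[z]$ is the symmetric matrix indexed by $\alpha,\beta\in\mathbb N^n$ with $|\alpha|,|\beta|\le k-\lceil\deg(q)/2\rceil$, with $(\alpha,\beta)$ entry $\sum_\gamma q_\gamma z_{\alpha+\beta+\gamma}$; $M_k[z]=L^{(k)}_1[z]$. $\Sigma[x]_{2d_1}$ is the cone of SOS polynomials of degree $\le 2d_1$; ''generic $R$'' means outside a Lebesgue-measure-zero subset of its interior. *)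

(* Defs.v *)
From HB Require Import structures.
From mathcomp Require Import all_boot all_order all_algebra.
From mathcomp Require Import mpoly.
From mathcomp Require Import all_classical all_reals all_analysis.
Set Implicit Arguments. Unset Strict Implicit. Unset Printing Implicit Defensive.
Import Order.TTheory GRing.Theory Num.Theory.
Local Open Scope classical_set_scope.
Local Open Scope ring_scope.

Section Defs.
Context {R : realType} {n : nat}.
Local Notation poly := (mpoly.mpoly n R).
Local Notation mnm := (mpoly.multinom n).
Local Notation pt := (n.-tuple R).          (* points of R^n (Borel product sigma-algebra) *)

Definition mexp (al : mnm) (i : 'I_n) : nat := mpoly.fun_of_multinom al i.
Definition mdeg (al : mnm) : nat := mpoly.mdeg al.
Definition mono_eval (al : mnm) (u : pt) : R := \prod_(i < n) (tnth u i) ^+ mexp al i.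
Definition peval (p : poly) (u : pt) : R := mpoly.meval (tnth u) p.
(* total degree (deg 0 := 0) *)
Definition pdeg (p : poly) : nat := (\max_(al <- mpoly.msupp p) mpoly.mdeg al)%N.
Definition hom_part (p : poly) : poly :=
  \sum_(al <- mpoly.msupp p | mpoly.mdeg al == pdeg p)
     mpoly.mcoeff al p *: mpoly.mpolyX R al.
Definition sphere_poly : poly :=
  \sum_(i < n) (mpoly.mpolyX R (mpoly.mnm1 i)) ^+ 2 - 1.

(* (truncated) moment vectors: only entries with |alpha| <= t are relevant *)
Definition mvec := mnm -> R.

Definition pairing (p : poly) (y : mvec) : R :=
  \sum_(al <- mpoly.msupp p) mpoly.mcoeff al p * y al.

Definition trunc_eq (t : nat) (y y' : mvec) : Prop :=
  forall al, (mdeg al <= t)%N -> y al = y' al.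

Definition supported_in (mu : {measure set pt -> \bar R}) (T : set pt) : Prop :=
  measurable T /\ mu (~` T) = 0%E.

Definition in_Rt (t : nat) (T : set pt) (y : mvec) : Prop :=
  exists mu : {measure set pt -> \bar R}, supported_in mu T /\
    forall al, (mdeg al <= t)%N ->
      (\int[mu]_x (mono_eval al x)%:E = (y al)%:E)%E.

Definition Kcirc (cE cI : seq poly) : set pt :=
  [set u | (forall c, c \in cE -> peval (hom_part c) u = 0) /\
           (forall c, c \in cI -> 0 <= peval (hom_part c) u) /\
           \sum_(i < n) (tnth u i) ^+ 2 = 1].

Definition dc (cE cI : seq poly) : nat :=
  (\max_(c <- cE ++ cI) uphalf (pdeg c))%N.

(* localizing matrix L^{(k)}_q[z]: size bound and (alpha,beta) entry *)
Definition loc_size (k : nat) (q : poly) : nat := (k - uphalf (pdeg q))%N.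
Definition loc_entry (q : poly) (z : mvec) (al be : mnm) : R :=
  \sum_(ga <- mpoly.msupp q)
     mpoly.mcoeff ga q * z (mpoly.mnm_add (mpoly.mnm_add al be) ga).

Definition loc_zero (k : nat) (q : poly) (z : mvec) : Prop :=
  forall al be : mnm, (mdeg al <= loc_size k q)%N -> (mdeg be <= loc_size k q)%N ->
    loc_entry q z al be = 0.

Definition loc_psd (k : nat) (q : poly) (z : mvec) : Prop :=
  forall v : mnm -> R,
    0 <= \sum_(al : mpoly.bmultinom n (loc_size k q).+1)
         \sum_(be : mpoly.bmultinom n (loc_size k q).+1)
           v (mpoly.bmnm al) * v (mpoly.bmnm be) *
             loc_entry q z (mpoly.bmnm al) (mpoly.bmnm be).

Definition is_sos (t : nat) (q : poly) : Prop :=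
  (pdeg q <= t)%N /\ exists s : seq poly, q = \sum_(h <- s) h ^+ 2.

Definition sos_interior (t : nat) (Rp : poly) : Prop :=
  (pdeg Rp <= t)%N /\
  exists2 eps : R, 0 < eps &
    forall q : poly, (pdeg q <= t)%N ->
      (forall al, (mdeg al <= t)%N -> `|mpoly.mcoeff al q - mpoly.mcoeff al Rp| < eps) ->
      is_sos t q.

(* N has Lebesgue measure zero in R[x]_t = R^{N^n_t} (coefficient coordinates):
   for every eps > 0 it is covered by countably many boxes of total volume < eps *)
Definition coef_null (t : nat) (N : set poly) : Prop :=
  forall eps : R, 0 < eps ->
    exists lo hi : nat -> mnm -> R,
      (forall j al, lo j al <= hi j al) /\
      (forall p, N p -> exists j, forall al, (mdeg al <= t)%N ->
          lo j al <= mpoly.mcoeff al p <= hi j al) /\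
      (forall K, \sum_(j < K) \prod_(al : mpoly.bmultinom n t.+1)
                    (hi j (mpoly.bmnm al) - lo j (mpoly.bmnm al)) < eps).

Definition sdp_feasible (cE cI : seq poly) (m : nat) (g : 'I_m -> poly) (a : 'I_m -> R)
    (k : nat) (z : mvec) : Prop :=
  (forall i, pairing (g i) z <= a i) /\
  (forall c, c \in cE -> loc_zero k (hom_part c) z) /\
  (forall c, c \in cI -> loc_psd k (hom_part c) z) /\
  loc_zero k sphere_poly z /\
  loc_psd k 1 z.

Definition accum_point (t k0 : nat) (zk : nat -> mvec) (z : mvec) : Prop :=
  forall eps : R, 0 < eps -> forall K : nat,
    exists k, (K <= k)%N /\ (k0 <= k)%N /\
      forall al, (mdeg al <= t)%N -> `|zk k al - z al| < eps.

End Defs.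

(* Main.v *)
(** Let [C] be the cone spanned by the truncated moment vectors of the points of
    [K°]. Since [K°] is compact and the entry of index [0] of these vectors is [1],
    [C] is closed; by separation it is exactly the set of moment vectors of
    measures on [K°]. For an objective in the interior of the SOS cone, sublevel
    sets of the program over [C] are compact, so minimizers exist.

    The map from objectives to minimizers is monotone, and the points where a
    monotone map is multivalued lie on countably many Lipschitz graphs, which are
    null; so minimizers are unique for generic objectives. A unique minimizer is
    an extreme point of [C] cut by [m] half-spaces, hence has at most [m]
    independent atoms.

    For the relaxations, writing the objective as a positive constant plus a sum
    of squares bounds the mass of feasible points, and the sphere constraint then
    bounds all moments. A limit of relaxed minimizers is a functional [L] on all
    polynomials which is nonnegative on the quadratic module. Modulo the sphere,
    [1 + x_i] and [1 - x_i] are sums of squares, so [L] is nonnegative on the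
    Bernstein basis of the box, hence on polynomials nonnegative on the box, and
    then, by compensating with elements of the quadratic module, on polynomials
    positive on [K°]. Thus the limit lies in [C], and it is optimal. *)

Require Import Defs.
From HB Require Import structures.
From mathcomp Require Import all_boot all_order all_algebra.
From mathcomp Require Import ssrcomplements mpoly.
From mathcomp Require Import all_classical all_reals all_analysis measurable_realfun.
From mathcomp Require Import ring lra.
Import Order.TTheory GRing.Theory Num.Theory.
Import numFieldNormedType.Exports.
Local Open Scope classical_set_scope.
Local Open Scope ring_scope.

Set Implicit Arguments.
Unset Strict Implicit.
Unset Printing Implicit Defensive.

(** * Limits along a free ultrafilter, cones and their programs *)

Section SumLimits.
Context {R : realType} {I : Type} {F : set_system I} {FF : Filter F}.

Lemma cvg_sumr (J : Type) (s : seq J) (P : pred J) (f : J -> I -> R) (l : J -> R) :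
  (forall j, f j @ F --> l j) ->
  (fun k => \sum_(j <- s | P j) f j k) @ F --> \sum_(j <- s | P j) l j.
Proof.
move=> fl; elim: s => [|j s IHs].
  by under eq_fun do rewrite big_nil; rewrite big_nil; exact: cvg_cst.
rewrite big_cons; under eq_fun do rewrite big_cons.
by case: (P j) => //; apply: cvgD.
Qed.

Lemma cvg_prodr (J : Type) (s : seq J) (f : J -> I -> R) (l : J -> R) :
  (forall j, f j @ F --> l j) ->
  (fun k => \prod_(j <- s) f j k) @ F --> \prod_(j <- s) l j.
Proof.
move=> fl; elim: s => [|j s IHs].
  by under eq_fun do rewrite big_nil; rewrite big_nil; exact: cvg_cst.
rewrite big_cons; under eq_fun do rewrite big_cons.
exact: cvgM.
Qed.

Lemma cvg_exprn (f : I -> R) (l : R) m :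
  f @ F --> l -> (fun k => f k ^+ m) @ F --> l ^+ m.
Proof.
move=> fl; elim: m => [|m IHm].
  by under eq_fun do rewrite expr0; rewrite expr0; exact: cvg_cst.
by rewrite exprS; under eq_fun do rewrite exprS; exact: cvgM.
Qed.

End SumLimits.

(** A compact segment supplies a cluster point, and an ultrafilter converges to each of its cluster
    points. This replaces the extraction of subsequences. *)
Lemma ultra_bounded_cvg (R : realType) (I : Type) (U : set_system I)
    (UU : UltraFilter U) (x : I -> R) (B : R) :
  U [set k | `|x k| <= B] -> exists l : R, x @ U --> l.
Proof.
move=> xB.
have [] := @segment_compact R (- B) B (x @ U) _.
    have sB : [set k | `|x k| <= B] `<=` x @^-1` `[- B, B].
    by move=> k /=; rewrite in_itv /= -ler_norml.
  exact: filterS sB xB.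
move=> p [_ clp]; exists p => V pV.
have [//|UV] := in_ultra_setVsetC (x @^-1` V) UU.
by have [y []] := clp (~` V) V UV pV.
Qed.

Lemma free_ultrafilter : exists U : set_system nat, UltraFilter U /\ \oo `<=` U.
Proof. exact: ultraFilterLemma. Qed.

Lemma cvg_free_inv (R : realType) (U : set_system nat) {FU : Filter U} (Uoo : \oo `<=` U) :
  (fun k => k.+1%:R^-1 : R) @ U --> (0 : R).
Proof.
move=> V V0; apply: Uoo; exact: cvg_harmonic V V0.
Qed.

Section Dot.
Context {R : realType} {T : finType}.
Implicit Types (x y z : T -> R) (X : set (T -> R)).

Definition dot x y : R := \sum_t x t * y t.

Lemma dotDl x y z : dot (fun t => x t + y t) z = dot x z + dot y z.
Proof. by rewrite -big_split /=; apply: eq_bigr => t _; rewrite mulrDl. Qed.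

Lemma dotC x y : dot x y = dot y x.
Proof. by apply: eq_bigr => t _; rewrite mulrC. Qed.

Lemma dotDr x y z : dot z (fun t => x t + y t) = dot z x + dot z y.
Proof. by rewrite !(dotC z) dotDl. Qed.

Lemma dotZr (c : R) x y : dot x (fun t => c * y t) = c * dot x y.
Proof. by rewrite /dot mulr_sumr; apply: eq_bigr => t _; rewrite mulrCA. Qed.

Lemma eq_dotr x y z : (forall t, y t = z t) -> dot x y = dot x z.
Proof. by move=> yz; apply: eq_bigr => t _; rewrite yz. Qed.

Lemma dot_sumr (J : Type) (s : seq J) x (c : J -> R) (v : J -> T -> R) :
  dot x (fun t => \sum_(j <- s) c j * v j t) = \sum_(j <- s) c j * dot x (v j).
Proof.
rewrite /dot; under eq_bigr do rewrite mulr_sumr.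
rewrite exchange_big /=; apply: eq_bigr => j _; rewrite mulr_sumr.
by apply: eq_bigr => t _; rewrite mulrCA.
Qed.

Lemma cvg_dot (I : Type) (F : set_system I) {FF : Filter F} x (f : I -> T -> R) l :
  (forall t, (fun k => f k t) @ F --> l t) -> (fun k => dot x (f k)) @ F --> dot x l.
Proof. by move=> fl; apply: cvg_sumr => t; apply: cvgM (fl t); exact: cvg_cst. Qed.

Definition in_cone X z := exists r (lam : 'I_r -> R) (x : 'I_r -> T -> R),
  (forall j, 0 <= lam j) /\ (forall j, X (x j)) /\
  forall t, z t = \sum_j lam j * x j t.

Definition independent r (x : 'I_r -> T -> R) := forall w : 'I_r -> R,
  (forall t, \sum_j w j * x j t = 0) -> forall j, w j = 0.

End Dot.

Lemma exists_dependency (R : realType) (S : finType) r (v : 'I_r -> S -> R) :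
  (#|S| < r)%N ->
  exists2 w : 'I_r -> R, (exists j, w j != 0) & forall s, \sum_j w j * v j s = 0.
Proof.
move=> ltSr; pose A := \matrix_(i < r, j < #|S|) v i (enum_val j).
have kA0 : kermx A != 0.
  rewrite -mxrank_eq0 mxrank_ker subn_eq0 -ltnNge.
  exact: leq_ltn_trans (rank_leq_col A) ltSr.
have /rowV0Pn[w /sub_kermxP wA w0] := kA0.
exists (fun j => w 0 j); first by apply/rV0Pn.
move=> s; have /matrixP/(_ 0 (enum_rank s)) := wA; rewrite !mxE => wAs.
by apply: etrans wAs; apply: eq_bigr => j _; rewrite mxE enum_rankK.
Qed.

(** * Conic combinations and Caratheodory's theorem *)

Section Cone.
Context {R : realType} {T : finType}.
Implicit Types (x y z : T -> R) (X : set (T -> R)).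

Lemma independent_leq r (x : 'I_r -> T -> R) : independent x -> (r <= #|T|)%N.
Proof.
move=> ix; rewrite leqNgt; apply/negP => /(exists_dependency x)[w [j wj] w0].
by rewrite ix ?eqxx in wj.
Qed.

Lemma independent_inj r (x : 'I_r -> T -> R) : independent x -> injective x.
Proof.
move=> ix i j xij; apply/eqP; apply: contraT => ij.
have := ix (fun k => (k == i)%:R - (k == j)%:R).
case/(_ _ i)/eqP/idPn => [t|]; last by rewrite eqxx (negPf ij) subr0 oner_eq0.
under eq_bigr do rewrite mulrBl; rewrite sumrB (bigD1 i) //= eqxx mul1r.
rewrite big1 ?addr0; last by move=> k /negPf->; rewrite mul0r.
rewrite (bigD1 j) //= eqxx mul1r big1 ?addr0 ?xij ?subrr //.
by move=> k /negPf->; rewrite mul0r.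
Qed.

(** Moving the weights along a linear dependency of the atoms until one of them vanishes removes an
    atom; induction on the number of atoms does the rest. *)
Lemma caratheodory X z : in_cone X z ->
  exists r (lam : 'I_r -> R) (x : 'I_r -> T -> R),
  [/\ forall j, 0 < lam j, forall j, X (x j),
      forall t, z t = \sum_j lam j * x j t & independent x].
Proof.
case=> r; elim: r => [|r IHr] [lam [x [lam0 [Xx zE]]]].
  by exists 0%N, lam, x; split=> // [[]|w _ []].
have drop (mu : 'I_r.+1 -> R) j0 : (forall j, 0 <= mu j) -> mu j0 = 0 ->
    (forall t, z t = \sum_j mu j * x j t) ->
    exists r (lam : 'I_r -> R) (x : 'I_r -> T -> R),
    [/\ forall j, 0 < lam j, forall j, X (x j),
      forall t, z t = \sum_j lam j * x j t & independent x].
  move=> mu0 muj0 zmu; apply: IHr.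
  exists (fun j => mu (lift j0 j)), (fun j => x (lift j0 j)); do 2?split=> //.
  by move=> t; rewrite zmu (bigD1_ord j0) //= muj0 mul0r add0r.
have [[j lamj]|lamN0] := pselect (exists j, lam j = 0); first exact: drop lamj zE.
have lamP j : 0 < lam j.
  by rewrite lt_neqAle lam0 andbT eq_sym; apply/eqP => lj; apply: lamN0; exists j.
have [ix|/existsNP[w /not_implyP[w0 /existsNP[j1 wj1]]]] := pselect (independent x).
  by exists r.+1, lam, x.
wlog wj1P : w w0 wj1 / 0 < w j1.
  move=> H; have [wgt|wle] := ltP 0 (w j1); first exact: H wgt.
  apply: (H (fun j => - w j)).
  - by move=> t; under eq_bigr do rewrite mulNr; rewrite sumrN w0 oppr0.
  - by move=> /eqP; rewrite oppr_eq0 => /eqP.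
  - by rewrite oppr_gt0 lt_neqAle wle andbT; apply/eqP.
(* The minimal ratio [th] is the largest step that keeps every [lam j - th * w j] nonnegative, and
   it annihilates the weight of [j0]. *)
pose j0 := [arg min_(j < j1 | 0 < w j) (lam j / w j)]%O.
have [wj0 j0min] : 0 < w j0 /\ forall j, 0 < w j -> lam j0 / w j0 <= lam j / w j.
  by rewrite /j0; case: arg_minP => // i wi imin; split.
pose th := lam j0 / w j0.
apply: (drop (fun j => lam j - th * w j) j0).
- move=> j; rewrite subr_ge0; have [wj|wj] := ltP 0 (w j).
    by rewrite -ler_pdivlMr // j0min.
  apply: le_trans (lam0 j); rewrite mulr_ge0_le0 //.
  by rewrite divr_ge0 // ltW.
- by rewrite /th divfK ?subrr // gt_eqF.
- move=> t; under eq_bigr do rewrite mulrBl -mulrA.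
  by rewrite sumrB -mulr_sumr w0 mulr0 subr0.
Qed.

(** Padding with zero weights on the atom [x0] makes the number of atoms the same for all points, so
    that weights and atoms of a sequence in the cone can be followed index by index. *)
Lemma in_cone_card X x0 z : X x0 -> in_cone X z ->
  exists (lam : 'I_#|T| -> R) (x : 'I_#|T| -> T -> R),
  (forall j, 0 <= lam j) /\ (forall j, X (x j)) /\
  forall t, z t = \sum_j lam j * x j t.
Proof.
move=> Xx0 /caratheodory[r [lam [x [lam0 Xx zE /independent_leq ler]]]].
rewrite -(subnK ler); elim: (#|T| - r)%N => [|s [mu [y [mu0 [Xy zEy]]]]].
  by exists lam, x; split=> [j|//]; exact: ltW.
exists (fun j => oapp mu 0 (unlift ord0 j)), (fun j => oapp y x0 (unlift ord0 j)).
split; first by move=> j; case: unlift => //=.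
split; first by move=> j; case: unlift => //=.
move=> t; rewrite [RHS]big_ord_recl unlift_none /= mul0r add0r zEy.
by apply: eq_bigr => j _; rewrite liftK.
Qed.

Lemma in_coneD X y z : in_cone X y -> in_cone X z -> in_cone X (fun t => y t + z t).
Proof.
move=> [r [lam [x [lam0 [Xx yE]]]]] [s [mu [v [mu0 [Xv zE]]]]].
exists (r + s)%N, (fun j => match fintype.split j with inl i => lam i | inr i => mu i end),
  (fun j => match fintype.split j with inl i => x i | inr i => v i end).
split; first by move=> j; case: fintype.split.
split; first by move=> j; case: fintype.split.
move=> t; rewrite big_split_ord yE zE; congr (_ + _); apply: eq_bigr => j _.
  by rewrite (unsplitK (inl j)).
by rewrite (unsplitK (inr j)).
Qed.

Lemma in_coneZ X (c : R) z : 0 <= c -> in_cone X z -> in_cone X (fun t => c * z t).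
Proof.
move=> c0 [r [lam [x [lam0 [Xx zE]]]]].
exists r, (fun j => c * lam j), x; do 2?split=> //.
  by move=> j; rewrite mulr_ge0.
by move=> t; rewrite zE mulr_sumr; apply: eq_bigr => j _; rewrite mulrA.
Qed.

Lemma in_cone1 X x : X x -> in_cone X x.
Proof.
move=> Xx; exists 1%N, (fun=> 1), (fun=> x); do 2?split=> //.
by move=> t; rewrite big_ord1 mul1r.
Qed.

Lemma in_cone0 X : in_cone X (fun=> 0).
Proof.
exists 0%N, (fun=> 0), (fun _ _ => 0); split=> //; split; first by case.
by move=> t; rewrite big_ord0.
Qed.

Lemma in_cone_dot_ge0 X p z : (forall x, X x -> 0 <= dot p x) ->
  in_cone X z -> 0 <= dot p z.
Proof.
move=> p0 [r [lam [x [lam0 [Xx zE]]]]].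
rewrite (eq_dotr _ zE) dot_sumr; apply: sumr_ge0 => j _.
by rewrite mulr_ge0 // p0.
Qed.

End Cone.

(** * Closedness, separation and minimizers for cones over compact sets *)

Section Optimization.
Context {R : realType} {T : finType} (U : set_system nat) (UU : UltraFilter U).
Hypothesis Uoo : \oo `<=` U.
Variable X : set (T -> R).

(* Compactness of [X], tested only along the fixed ultrafilter. *)
Definition ultracompact := forall x : nat -> T -> R, (forall k, X (x k)) ->
  exists2 l, X l & forall t, (fun k => x k t) @ U --> l t.

Hypothesis cX : ultracompact.

(** Each atom contributes at least [eps] times its weight to [dot rho], so the weights are at most
    [B / eps]; weights and atoms then converge separately along [U]. *)
Lemma cone_ultralim (rho : T -> R) (eps B : R) (z : nat -> T -> R) : 0 < eps ->
  (forall x, X x -> eps <= dot rho x) ->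
  (forall k, in_cone X (z k)) -> (forall k, dot rho (z k) <= B) ->
  exists2 l, in_cone X l & forall t, (fun k => z k t) @ U --> l t.
Proof.
move=> eps0 rhoX cz zB.
have [[x0 Xx0]|X0] := pselect (exists x, X x); last first.
  have z0 k t : z k t = 0.
    have [[|r] [lam [x [_ [Xx ->]]]]] := cz k; first by rewrite big_ord0.
    by exfalso; apply: X0; exists (x ord0).
  exists (fun=> 0); first exact: in_cone0.
  by move=> t; under eq_fun do rewrite z0; exact: cvg_cst.
pose P k (q : ('I_#|T| -> R) * ('I_#|T| -> T -> R)) :=
  [/\ forall j, 0 <= q.1 j, forall j, X (q.2 j) & forall t, z k t = \sum_j q.1 j * q.2 j t].
have /choice[q qP] : forall k, exists q, P k q.
  by move=> k; have [lam [x [? [? ?]]]] := in_cone_card Xx0 (cz k); exists (lam, x).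
have lamB k j : (q k).1 j <= B / eps.
  have [l0 Xx zE] := qP k; rewrite ler_pdivlMr //; apply: le_trans (zB k).
  rewrite (eq_dotr _ zE) dot_sumr (bigD1 j) //= ler_wpDr //.
    apply: sumr_ge0 => i _; apply: mulr_ge0 => //.
    by apply: le_trans (rhoX _ (Xx i)); exact: ltW.
  by rewrite ler_wpM2l // rhoX.
have /choice[lam lamP] : forall j, exists l : R, (fun k => (q k).1 j) @ U --> l.
  move=> j; apply: (@ultra_bounded_cvg _ _ _ _ _ (B / eps)).
  by apply: filterE => k /=; rewrite ger0_norm //; have [] := qP k.
have /choice[x xP] : forall j, exists l, X l /\ forall t, (fun k => (q k).2 j t) @ U --> l t.
  move=> j; have [k|l Xl xl] := cX (x := fun k => (q k).2 j); last by exists l.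
  by have [] := qP k.
exists (fun t => \sum_j lam j * x j t).
  exists #|T|, lam, x; split; last by split=> // j; have [] := xP j.
  move=> j; apply: cvgr_to_ge (lamP j) _.
  by apply: filterE => k /=; have [] := qP k.
move=> t; rewrite [X in X @ _](_ : _ = fun k => \sum_j (q k).1 j * (q k).2 j t).
  by apply: cvg_sumr => j; apply: cvgM => //; have [] := xP j.
by apply: funext => k; have [] := qP k.
Qed.

Lemma minimizing_sequence (S : Type) (D : set S) (f : S -> R) (b : R) :
  D !=set0 -> (forall s, D s -> b <= f s) ->
  exists v (s : nat -> S), [/\ forall y, D y -> v <= f y, forall k, D (s k)
    & forall k, f (s k) <= v + k.+1%:R^-1].
Proof.
move=> [s0 Ds0] bf; pose E := [set f s | s in D].
have lE : has_lbound E by exists b => _ [s Ds <-]; exact: bf.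
have hE : has_inf E by split=> //; exists (f s0), s0.
have /choice[s sP] : forall k : nat, exists s, D s /\ f s <= inf E + k.+1%:R^-1.
  move=> k; have k0 : 0 < k.+1%:R^-1 :> R by rewrite invr_gt0 ltr0n.
  by have [_ [s Ds <-] /ltW fs] := inf_adherent k0 hE; exists s.
exists (inf E), s; split=> [y Dy|k|k].
- by apply: ge_inf => //; exists y.
- by have [] := sP k.
- by have [] := sP k.
Qed.

Lemma first_variation (c e : R) :
  0 <= e -> (forall s, 0 < s -> s <= 1 -> 0 <= 2 * s * c + s ^+ 2 * e) -> 0 <= c.
Proof.
move=> e0 H; rewrite leNgt; apply/negP => c0.
have d0 : 0 < e + 1 - c by lra.
(* For negative [c] this step satisfies [s * e < - c], hence [2 * c + s * e < c < 0]. *)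
pose s := - c / (e + 1 - c).
have s0 : 0 < s by rewrite divr_gt0 // oppr_gt0.
have s1 : s <= 1 by rewrite ler_pdivrMr //; lra.
have sE : s * (e + 1 - c) = - c by rewrite divfK // gt_eqF.
have : 0 <= s * (2 * c + s * e).
  by have := H s s0 s1; congr (_ <= _); ring.
by rewrite pmulr_rge0 // => H2; nra.
Qed.

(** The separating vector is [l - z], where [l] is the point of the cone nearest to [z], obtained as
    the limit of a minimizing sequence for the squared distance. *)
Lemma cone_separation (rho : T -> R) (eps : R) (z : T -> R) : 0 < eps ->
  (forall x, X x -> eps <= dot rho x) -> ~ in_cone X z ->
  exists2 p : T -> R, forall x, X x -> 0 <= dot p x & dot p z < 0.
Proof.
move=> eps0 rhoX nz.
pose sq (c : T -> R) : R := \sum_t (c t - z t) ^+ 2.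
have sq0 c : 0 <= sq c by apply: sumr_ge0 => t _; exact: sqr_ge0.
have [|v [c [vmin cc cv]]] := @minimizing_sequence _ (in_cone X) sq 0 _ (fun c _ => sq0 c).
  by exists (fun=> 0); exact: in_cone0.
have v0 : 0 <= v + 1.
  by apply: le_trans (sq0 (c 0%N)) _; apply: le_trans (cv 0%N) _; rewrite invr1.
have cB k t : `|c k t| <= `|z t| + v + 2.
  have h : (c k t - z t) ^+ 2 <= v + 1.
    apply: (@le_trans _ _ (sq (c k))).
      rewrite /sq (bigD1 t) //= ler_wpDr // sumr_ge0 // => i _; exact: sqr_ge0.
    apply: le_trans (cv k) _; rewrite lerD2l invf_le1 ?ltr0n // ler1n //.
  have h2 : `|c k t - z t| <= v + 2.
    rewrite -real_normK ?num_real // in h.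
    rewrite leNgt; apply/negP => h3; nra.
  have := ler_normD (c k t - z t) (z t); rewrite subrK; lra.
have cB2 k : dot rho (c k) <= \sum_t `|rho t| * (`|z t| + v + 2).
  apply: ler_sum => t _; apply: le_trans (ler_norm _) _.
  by rewrite normrM ler_wpM2l.
have [l cl cvl] := cone_ultralim eps0 rhoX cc cB2.
have lmin y : in_cone X y -> sq l <= sq y.
  move=> /vmin; apply: le_trans.
  have sl : (fun k => sq (c k)) @ U --> sq l.
    apply: cvg_sumr => t; apply: cvg_exprn; apply: cvgB => //; exact: cvg_cst.
  have vl : (fun k => v + k.+1%:R^-1) @ U --> v.
    by rewrite -[X in _ --> X]addr0; apply: cvgD; [exact: cvg_cst|exact: cvg_free_inv].
  by apply: (ler_cvg_to sl vl); exact: filterE.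
pose p t := l t - z t.
(* First-order optimality of [l] in a direction [y] that stays in the cone; it is applied to the
   points of [X] and to [- l]. *)
have var y : (forall s, 0 < s -> s <= 1 -> in_cone X (fun t => l t + s * y t)) ->
    0 <= dot p y.
  move=> cy; apply: (@first_variation _ (\sum_t y t ^+ 2)).
    by apply: sumr_ge0 => t _; exact: sqr_ge0.
  move=> s s0 s1; have := lmin _ (cy s s0 s1); rewrite -subr_ge0.
  rewrite /sq -sumrB /dot !mulr_sumr -big_split /=.
  by congr (_ <= _); apply: eq_bigr => t _; rewrite /p; ring.
exists p => [x Xx|].
  by apply: var => s s0 s1; apply: in_coneD => //; apply: in_coneZ (in_cone1 Xx); exact: ltW.
have pl : dot p l <= 0.
  suff : 0 <= dot p (fun t => - 1 * l t) by rewrite dotZr mulN1r oppr_ge0.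
  apply: var => s s0 s1; rewrite (_ : (fun t => _) = (fun t => (1 - s) * l t)).
    by apply: in_coneZ => //; rewrite subr_ge0.
  by apply: funext => t; ring.
have pp : 0 < dot p p.
  rewrite lt_neqAle; apply/andP; split; last first.
    by apply: sumr_ge0 => t _; rewrite -expr2 sqr_ge0.
  apply/eqP => /esym pp0; apply: nz; suff -> : z = l by [].
  apply: funext => t; apply/esym/eqP; rewrite -subr_eq0 -sqrf_eq0 expr2.
  apply/eqP; move/eqP: pp0; rewrite psumr_eq0 => [/allP/(_ t)|i _].
    by rewrite mem_index_enum => /(_ isT) /eqP.
  by rewrite -expr2 sqr_ge0.
have -> : dot p z = dot p l - dot p p.
  by rewrite /dot -sumrB; apply: eq_bigr => t _; rewrite /p; ring.
lra.
Qed.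

Section Program.
Variables (m : nat) (G : 'I_m -> T -> R) (a : 'I_m -> R).

Definition feasible (z : T -> R) := in_cone X z /\ forall i, dot (G i) z <= a i.

Definition minimizer (rho z : T -> R) :=
  feasible z /\ forall y, feasible y -> dot rho z <= dot rho y.

Lemma minimizer_exists (rho : T -> R) (eps : R) : 0 < eps ->
  (forall x, X x -> eps <= dot rho x) -> feasible !=set0 ->
  exists z, minimizer rho z.
Proof.
move=> eps0 rhoX f0.
have rho0 y : feasible y -> 0 <= dot rho y.
  case=> cy _; apply: in_cone_dot_ge0 cy => x Xx; apply: le_trans (rhoX x Xx); exact: ltW.
have [v [z [vmin fz zv]]] := minimizing_sequence f0 rho0.
have zB k : dot rho (z k) <= v + 1.
  by apply: le_trans (zv k) _; rewrite lerD2l invf_le1 ?ltr0n // ler1n.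
have [l cl cvl] := cone_ultralim eps0 rhoX (fun k => proj1 (fz k)) zB.
exists l; split.
  split=> // i; apply: (cvgr_to_le (cvg_dot (x := G i) cvl)).
  by apply: filterE => k /=; exact: (fz k).2.
move=> y /vmin; apply: le_trans.
have vl : (fun k => v + k.+1%:R^-1) @ U --> v.
  by rewrite -[X in _ --> X]addr0; apply: cvgD; [exact: cvg_cst|exact: cvg_free_inv].
by apply: (ler_cvg_to (cvg_dot (x := rho) cvl) vl); exact: filterE.
Qed.

Lemma small_multiple r (lam w : 'I_r -> R) : (forall j, 0 < lam j) ->
  exists2 e : R, 0 < e & forall j, e * `|w j| <= lam j.
Proof.
elim: r lam w => [|r IHr] lam w lam0; first by exists 1 => // [[]].
have [e e0 eP] := IHr (fun j => lam (lift ord0 j)) (fun j => w (lift ord0 j)) (fun j => lam0 _).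
pose e' := lam ord0 / (`|w ord0| + 1).
have w1 : 0 < `|w ord0| + 1 by rewrite ltr_wpDl.
have e'0 : 0 < e' by rewrite divr_gt0.
exists (Num.min e e') => [|j]; first by rewrite lt_min e0.
have [->|[i ->]] : j = ord0 \/ exists i, j = lift ord0 i.
  by case: (unliftP ord0 j) => [i|]->; [right; exists i|left].
  apply: (@le_trans _ _ (e' * (`|w ord0| + 1))); last by rewrite divfK // gt_eqF.
  by apply: ler_pM => //; rewrite ?ge_min ?lexx ?orbT ?lerDl // le_min !ltW.
by apply: le_trans (eP i); apply: ler_pM => //; rewrite ?ge_min ?lexx // le_min !ltW.
Qed.

(* With more than [m] independent atoms the weights can be moved both ways
   without changing the constraints, which would yield a second minimizer. *)
Lemma unique_minimizer_atoms (rho z : T -> R) : minimizer rho z ->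
  (forall y, minimizer rho y -> y = z) ->
  exists r (lam : 'I_r -> R) (x : 'I_r -> T -> R), (r <= m)%N /\
    [/\ forall j, 0 < lam j, forall j, X (x j), injective x
      & forall t, z t = \sum_j lam j * x j t].
Proof.
move=> [[cz Gz] zmin] zuniq.
have [r [lam [x [lam0 Xx zE ix]]]] := caratheodory cz.
exists r, lam, x; split; last by split=> //; exact: independent_inj.
rewrite leqNgt; apply/negP => ltmr.
(* The constraint values at the atoms are [r] vectors in dimension [m < r]; a dependency among them
   is a change of weights that leaves every constraint value fixed. *)
have [|w [j0 wj0] wG] := @exists_dependency R 'I_m r (fun j i => dot (G i) (x j)).
  by rewrite card_ord.
pose y (w : 'I_r -> R) t := \sum_j w j * x j t.
(* Up to a change of sign, the objective does not increase along this direction. *)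
have [w' [w'j0 w'G w'rho]] : exists w' : 'I_r -> R, [/\ w' j0 != 0,
    forall i, dot (G i) (y w') = 0 & dot rho (y w') <= 0].
  have wG' i : dot (G i) (y w) = 0 by rewrite dot_sumr wG.
  have [h|h] := leP (dot rho (y w)) 0; first by exists w.
  have yN t : y (fun j => - w j) t = -1 * y w t.
    by rewrite /y mulr_sumr; apply: eq_bigr => j _; ring.
  exists (fun j => - w j); split; first by rewrite oppr_eq0.
    by move=> i; rewrite (eq_dotr _ yN) dotZr wG' mulr0.
  by rewrite (eq_dotr _ yN) dotZr mulN1r oppr_le0 ltW.
have [e e0 ew] := small_multiple w' lam0.
have z'E t : z t + e * y w' t = \sum_j (lam j + e * w' j) * x j t.
  by rewrite zE /y mulr_sumr -big_split; apply: eq_bigr => j _ /=; ring.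
have z'f : feasible (fun t => z t + e * y w' t).
  split; last by move=> i; rewrite dotDr dotZr w'G mulr0 addr0.
  exists r, (fun j => lam j + e * w' j), x; do 2?split=> //.
  move=> j; have := ew j; have := ler_norm (- (e * w' j)).
  by rewrite normrN normrM (gtr0_norm e0); lra.
have /zuniq z'z : minimizer rho (fun t => z t + e * y w' t).
  split=> // u /zmin; apply: le_trans.
  by rewrite dotDr dotZr gerDl pmulr_rle0.
have : forall j, w' j = 0.
  apply: ix => t; have /(congr1 (fun f => f t)) /= /eqP := z'z.
  by rewrite -subr_eq0 addrAC subrr add0r mulf_eq0 (gt_eqF e0) /= => /eqP.
by move=> /(_ j0) /eqP; exact/negP.
Qed.

End Program.

End Optimization.

(** * Null sets and monotone maps *)

Section NullSets.
Context {R : realType} {T : finType} (t0 : T).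

Definition box_volume (lo hi : T -> R) : R := \prod_t (hi t - lo t).

Definition box_null (S : set (T -> R)) := forall eps : R, 0 < eps ->
  exists lo hi : nat -> T -> R,
    [/\ forall j t, lo j t <= hi j t,
        forall x, S x -> exists j, forall t, lo j t <= x t <= hi j t
      & forall K, \sum_(j < K) box_volume (lo j) (hi j) < eps].

Lemma box_volume_ge0 lo hi : (forall t, lo t <= hi t) -> 0 <= box_volume lo hi.
Proof. by move=> lohi; apply: prodr_ge0 => t _; rewrite subr_ge0. Qed.

Lemma ler_sum_subseq (I : eqType) (f : I -> R) (s s' : seq I) :
  (forall i, 0 <= f i) -> uniq s -> uniq s' -> {subset s <= s'} ->
  \sum_(i <- s) f i <= \sum_(i <- s') f i.
Proof.
move=> f0 us us' ss'.
rewrite (perm_big [seq i <- s' | i \in s]) /=; last first.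
  apply: uniq_perm => //; first exact: filter_uniq.
  by move=> i; rewrite mem_filter; case: (boolP (i \in s)) => // /ss' ->.
rewrite big_filter big_mkcond /=; apply: ler_sum => i _.
by case: ifP.
Qed.

(** Boxes are renumbered through [pickle]. Numbers that encode no index receive a box reduced to the
    origin, of volume zero because [t0] makes the product nonempty. *)
Lemma countable_cover (I : countType) (lo hi : I -> T -> R) (S : set (T -> R)) (eps : R) :
  0 < eps ->
  (forall i t, lo i t <= hi i t) ->
  (forall x, S x -> exists i, forall t, lo i t <= x t <= hi i t) ->
  (forall s, uniq s -> \sum_(i <- s) box_volume (lo i) (hi i) < eps) ->
  exists lo hi : nat -> T -> R,
    [/\ forall j t, lo j t <= hi j t,
        forall x, S x -> exists j, forall t, lo j t <= x t <= hi j t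
      & forall K, \sum_(j < K) box_volume (lo j) (hi j) < eps].
Proof.
move=> eps0 lohi cov vol.
exists (fun j => oapp lo (fun=> 0) (pickle_inv j : option I)), (fun j => oapp hi (fun=> 0) (pickle_inv j : option I)).
split=> [j t|x /cov[i xi]|K]; first by case: pickle_inv => /=.
  by exists (pickle i); rewrite pickleK_inv.
pose f i := box_volume (lo i) (hi i).
rewrite (eq_bigr (fun j : 'I_K => oapp f 0 (pickle_inv j : option I))); last first.
  move=> j _; case: pickle_inv => //=.
  by rewrite /box_volume (bigD1 t0) //= subrr mul0r.
rewrite -(big_mkord xpredT (fun j => oapp f 0 (pickle_inv j : option I))) /=.
have -> s : \sum_(j <- s) oapp f 0 (pickle_inv j : option I) = \sum_(i <- pmap (@pickle_inv I) s) f i.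
  elim: s => [|j s IHs]; first by rewrite !big_nil.
  by rewrite big_cons /= IHs; case: pickle_inv => /= [i|]; rewrite ?big_cons ?add0r.
apply: vol; apply: pmap_uniq (iota_uniq _ _).
exact: pickle_invK.
Qed.

Lemma geometric_half (eps : R) K : 0 < eps -> \sum_(i < K) eps / 2 ^+ i.+1 < eps.
Proof.
move=> eps0; suff -> : \sum_(i < K) eps / 2 ^+ i.+1 = eps - eps / 2 ^+ K.
  by rewrite ltrBlDr ltrDl divr_gt0 // exprn_gt0.
elim: K => [|K IHK]; first by rewrite big_ord0 expr0 divr1 subrr.
have K0 : (2 : R) ^+ K != 0 by rewrite expf_neq0.
by rewrite big_ord_recr /= IHK exprS; field.
Qed.

(** The set of index [i] gets the share [eps / 2 ^+ i.+1] of the volume. *)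
Lemma box_null_bigcup (S : nat -> set (T -> R)) : (forall i, box_null (S i)) ->
  box_null [set x | exists i, S i x].
Proof.
move=> nS eps eps0.
pose P i (q : (nat -> T -> R) * (nat -> T -> R)) := [/\ forall j t, q.1 j t <= q.2 j t,
        forall x, S i x -> exists j, forall t, q.1 j t <= x t <= q.2 j t
      & forall K, \sum_(j < K) box_volume (q.1 j) (q.2 j) < eps / 2 ^+ i.+1].
have /choice[q qP] : forall i, exists q, P i q.
  move=> i; have [|lo [hi H]] := nS i (eps / 2 ^+ i.+1); last by exists (lo, hi).
  by rewrite divr_gt0 // exprn_gt0.
apply: (@countable_cover (nat * nat)%type (fun p => (q p.1).1 p.2) (fun p => (q p.1).2 p.2)) => //.
- by move=> [i j] t /=; have [] := qP i.
- by move=> x [i Six]; have [_ /(_ _ Six)[j xj] _] := qP i; exists (i, j).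
move=> s us; pose K := (\max_(p <- s) maxn p.1 p.2).+1.
pose s' := [seq (i, j) | i <- iota 0 K, j <- iota 0 K].
apply: le_lt_trans (@ler_sum_subseq _ _ s s' _ us _ _) _.
- by move=> [i j]; apply: box_volume_ge0 => t /=; have [] := qP i.
- by apply: allpairs_uniq; rewrite ?iota_uniq // => -[? ?] [? ?].
- move=> [i j] ijs; apply/allpairsP; exists (i, j); split=> //; rewrite mem_iota add0n ltnS.
    by apply: leq_trans (leq_maxl i j) _; exact: (@leq_bigmax_seq _ s xpredT (fun p => maxn p.1 p.2) _ ijs).
  by apply: leq_trans (leq_maxr i j) _; exact: (@leq_bigmax_seq _ s xpredT (fun p => maxn p.1 p.2) _ ijs).
rewrite big_allpairs /=; apply: le_lt_trans (geometric_half K eps0).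
rewrite -[X in _ <= X](big_mkord xpredT (fun i => eps / 2 ^+ i.+1)) /=.
rewrite /index_iota subn0; apply: ler_sum => i _; apply/ltW.
have [_ _ /(_ K)] := qP i.
by rewrite -(big_mkord xpredT (fun j => box_volume ((q i).1 j) ((q i).2 j))) /index_iota subn0.
Qed.

Lemma grid_cell (P : nat) (h y : R) : (0 < P)%N -> 0 <= y -> y <= P%:R * h ->
  exists j : 'I_P, j%:R * h <= y <= j.+1%:R * h.
Proof.
case: P => // P _ y0; elim: P => [|P IHP] yP.
  by exists ord0; rewrite mul0r y0.
have [/IHP[j jP]|Py] := leP y (P.+1%:R * h).
  by exists (widen_ord (leqnSn _) j).
by exists ord_max; rewrite yP ltW.
Qed.

(* Each of the [P ^ (#|T| - 1)] columns of width [h = 2 M / P] over the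
   hyperplane [x b = 0] meets [S] within a height proportional to [h]. *)
Lemma lipschitz_graph_null (S : set (T -> R)) (b : T) (C M : R) :
  0 <= C -> 0 <= M -> (forall x t, S x -> `|x t| <= M) ->
  (forall x y, S x -> S y -> `|x b - y b| <= C * \sum_(t | t != b) `|x t - y t|) ->
  box_null S.
Proof.
move=> C0 M0 SM SL eps eps0.
pose N := #|[pred t | t != b]|; pose D := C * N%:R.
have D0 : 0 <= D by rewrite mulr_ge0.
(* [W / P] is the total volume of the cover: [P ^ N] boxes with base [h ^ N] and height [2 D h],
   where [P h = 2 M]. *)
pose W := (2 * M) ^+ N.+1 * (2 * D).
have W0 : 0 <= W by rewrite !mulr_ge0 ?exprn_ge0 // mulr_ge0.
pose P := (Num.truncn (W / eps)).+1.
have WP : W / P%:R < eps.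
  rewrite ltr_pdivrMr ?ltr0n // mulrC -ltr_pdivrMr //.
  exact: truncnS_gt.
pose h := 2 * M / P%:R.
have h0 : 0 <= h by rewrite divr_ge0 // mulr_ge0.
have Ph : P%:R * h = 2 * M by rewrite mulrC divfK // pnatr_eq0.
pose T' := {t : T | t != b}.
pose column (J : {ffun T' -> 'I_P}) (x : T -> R) :=
  forall t' : T', - M + (J t')%:R * h <= x (val t') <= - M + (J t').+1%:R * h.
(* The height of any one point of [S] in the column serves as centre; in an empty column any value
   will do. *)
have /choice[c cP] : forall J, exists c : R,
    forall x, S x -> column J x -> `|x b - c| <= D * h.
  move=> J; have [[y [Sy Jy]]|nJ] := pselect (exists y, S y /\ column J y); last first.
    by exists 0 => x Sx Jx; exfalso; apply: nJ; exists x.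
  exists (y b) => x Sx Jx; apply: le_trans (SL _ _ Sx Sy) _.
  rewrite -mulrA ler_wpM2l //.
  apply: (@le_trans _ _ (\sum_(t | t != b) h)); last first.
    by rewrite sumr_const -[X in X <= _]mulr_natl.
  apply: ler_sum => t tb.
  have := Jx (Sub t tb); have := Jy (Sub t tb); rewrite /= -!natr1 !mulrDl.
  by move=> /andP[? ?] /andP[? ?]; rewrite ler_norml; apply/andP; split; lra.
pose lo (J : {ffun T' -> 'I_P}) t := if insub t is Some t' then - M + (J t')%:R * h else c J - D * h.
pose hi (J : {ffun T' -> 'I_P}) t := if insub t is Some t' then - M + (J t').+1%:R * h else c J + D * h.
have Dh : 0 <= D * h by rewrite mulr_ge0.
have lohi J t : lo J t <= hi J t.
  rewrite /lo /hi; case: insubP => [t' _ _|_]; last by lra.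
  by rewrite -natr1 mulrDl; lra.
have volE J : box_volume (lo J) (hi J) = 2 * D * h ^+ N.+1.
  rewrite /box_volume (bigD1 b) //= /lo /hi insubF ?eqxx //.
  rewrite (eq_bigr (fun=> h)); last first.
    by move=> t tb; rewrite (insubT (fun t => t != b) tb) /= -natr1 mulrDl; lra.
  by rewrite prodr_const exprS -/N; ring.
apply: (countable_cover eps0 lohi).
- move=> x Sx.
  have /choice[J JP] : forall t' : T', exists j : 'I_P,
      j%:R * h <= x (val t') + M <= j.+1%:R * h.
    move=> t'; apply: grid_cell => //; rewrite ?Ph;
    have := SM x (val t') Sx; rewrite ler_norml => /andP[]; lra.
  pose J' := [ffun t' => J t'].
  have xJ : column J' x.
    by move=> t'; rewrite !ffunE; have /andP[? ?] := JP t'; apply/andP; split; lra.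
  exists J' => t; rewrite /lo /hi; case: insubP => [t' _ <-|]; first exact: xJ.
  rewrite negbK => /eqP ->; have := cP J' x Sx xJ; rewrite ler_norml => /andP[? ?].
  by apply/andP; split; lra.
move=> s us; apply: le_lt_trans (@ler_sum_subseq _ _ s (index_enum _) _ us _ _) _.
- by move=> J; exact: box_volume_ge0.
- exact: index_enum_uniq.
- by move=> J _; rewrite mem_index_enum.
under eq_bigr do rewrite volE.
rewrite sumr_const card_ffun card_ord card_sig -/N -[X in X < _]mulr_natl natrX.
suff -> : P%:R ^+ N * (2 * D * h ^+ N.+1) = W / P%:R by [].
have P0 : P%:R != 0 :> R by rewrite pnatr_eq0.
have mE (p y : R) : p != 0 -> p ^+ N * (2 * D * y ^+ N.+1) = (p * y) ^+ N.+1 * (2 * D) / p.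
  by move=> p0; rewrite exprMn [p ^+ N.+1]exprSr; field.
by rewrite mE // Ph.
Qed.

Lemma rat_approx (y e : R) : 0 < e -> exists q : rat, `|ratr q - y| <= e.
Proof.
move=> e0; have [|q] := @rat_in_itvoo R (y - e) (y + e); first lra.
rewrite in_itv /= => /andP[? ?]; exists q.
by rewrite ler_norml; apply/andP; split; lra.
Qed.

(* Points whose two values are close to fixed [u] and [v] lie on a Lipschitz
   graph over the hyperplane orthogonal to a maximal coordinate of [u - v]:
   monotonicity makes differences of such points almost orthogonal to [u - v]. *)
Lemma monotone_multivalued_null (A : (T -> R) -> (T -> R) -> Prop) :
  (forall x y s s', A x s -> A y s' -> \sum_t (x t - y t) * (s t - s' t) <= 0) ->
  box_null [set x | exists s s', [/\ A x s, A x s' & s <> s']].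
Proof.
move=> Amono.
(* The pieces are indexed by countable data: rational approximations of the two values, a coordinate
   [b] and a bound on [x]. *)
pose piece (q : {ffun T -> rat} * {ffun T -> rat} * T * nat) : set (T -> R) :=
  let u t : R := ratr (q.1.1.1 t) in let v t : R := ratr (q.1.1.2 t) in
  let b := q.1.2 in let e := `|u b - v b| in
  [set x | [/\ 0 < e, forall t, `|u t - v t| <= 2 * e, forall t, `|x t| <= q.2%:R
    & exists s s', [/\ A x s, A x s',
        forall t, `|s t - u t| <= e / 8 & forall t, `|s' t - v t| <= e / 8]]].
have piece_null q : box_null (piece q).
  move: q => [[[qu qv] b] M]; rewrite /piece /=.
  pose u t : R := ratr (qu t); pose v t : R := ratr (qv t).
  (* The constant 3: with [db] the difference at [b] and [sg] the sum of the others, the estimates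
     below give [e db <= e / 4 (db + sg) + 2 e sg], that is [db <= 3 sg]. *)
  apply: (@lipschitz_graph_null _ b 3 M%:R) => //.
    by move=> x t [].
  move=> x y [e0 uv _ [s [s' [xs xs' su s'v]]]] [_ _ _ [r [r' [yr yr' ru r'v]]]].
  rewrite -/(u b) -/(v b) in e0 uv su s'v ru r'v.
  set e := `|u b - v b| in e0 uv su s'v ru r'v.
  (* Monotonicity holds for the actual values; replacing each of them by its rational approximation
     costs [e / 8]. *)
  have key (a1 a2 : T -> R) (p1 p2 : T -> R) : (forall t, `|a1 t - p1 t| <= e / 8) ->
      (forall t, `|a2 t - p2 t| <= e / 8) -> \sum_t (x t - y t) * (a1 t - a2 t) <= 0 ->
      \sum_t (x t - y t) * (p1 t - p2 t) <= \sum_t e / 4 * `|x t - y t|.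
    move=> h1 h2 h3; apply: (@le_trans _ _ (\sum_t ((x t - y t) * (a1 t - a2 t) + e / 4 * `|x t - y t|))); last by rewrite big_split /= gerDr.
    apply: ler_sum => t _; rewrite -lerBlDl -mulrBr.
    apply: le_trans (ler_norm _) _; rewrite normrM mulrC ler_wpM2r //.
    have -> : p1 t - p2 t - (a1 t - a2 t) = (a2 t - p2 t) - (a1 t - p1 t) by ring.
    apply: le_trans (ler_normB _ _) _; have := h1 t; have := h2 t; lra.
  have k1 := key s r' u v su r'v (Amono _ _ _ _ xs yr').
  have k2 := key s' r v u s'v ru (Amono _ _ _ _ xs' yr).
  have nk2 : - (\sum_t e / 4 * `|x t - y t|) <= \sum_t (x t - y t) * (u t - v t).
    rewrite lerNl -sumrN; apply: le_trans k2; rewrite le_eqVlt; apply/orP; left; apply/eqP.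
    by apply: eq_bigr => t _; rewrite /u /v; ring.
  have {k1 nk2 k2 key} k : `|\sum_t (x t - y t) * (u t - v t)| <= \sum_t e / 4 * `|x t - y t|.
    by rewrite ler_norml nk2.
  have k3 : `|(x b - y b) * (u b - v b)| <= `|\sum_t (x t - y t) * (u t - v t)| +
      \sum_(t | t != b) 2 * e * `|x t - y t|.
    have -> : (x b - y b) * (u b - v b) = \sum_t (x t - y t) * (u t - v t) -
        \sum_(t | t != b) (x t - y t) * (u t - v t).
      by rewrite [X in _ = X - _](bigD1 b) //= addrK.
    apply: le_trans (ler_normB _ _) _; rewrite lerD2l.
    apply: le_trans (ler_norm_sum _ _ _) _; apply: ler_sum => t _.
    by rewrite normrM mulrC ler_wpM2r //; exact: uv.
  move: k; rewrite [X in _ <= X](bigD1 b) //= -mulr_sumr => k.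
  move: k3; rewrite normrM -/e -mulr_sumr.
  move: k; set n1 := `|\sum_t _|; set sg := \sum_(_ | _) _; set db := `|_ - _|.
  move=> k k3; have : e * (3 * sg - db) >= 0 by nra.
  by rewrite pmulr_rge0 // subr_ge0.
pose cover i := if unpickle i is Some q then piece q else set0.
suff : box_null [set x | exists i, cover i x].
  move=> H eps /H[lo [hi [lohi cov vol]]]; exists lo, hi; split=> // x [s [s' [xs xs' ss']]].
  apply: cov.
  pose b := [arg max_(t > t0) `|s t - s' t|]%O.
  have bmax t : `|s t - s' t| <= `|s b - s' b|.
    by rewrite /b; case: arg_maxP => // i _; apply.
  have z0 : 0 < `|s b - s' b|.
    rewrite normr_gt0 subr_eq0; apply/eqP => sb; apply: ss'; apply: funext => t.
    have := bmax t; rewrite sb subrr normr0 normr_le0 subr_eq0; exact/eqP.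
  set z := `|s b - s' b| in bmax z0.
  (* With errors [z / 10] one gets [e >= 4 z / 5], so that [z / 10 <= e / 8] and
     [|u t - v t| <= 6 z / 5 <= 2 e]. *)
  have z10 : 0 < z / 10 by lra.
  have /choice[u uP] : forall t, exists q : rat, `|ratr q - s t| <= z / 10.
    by move=> t; exact: rat_approx.
  have /choice[v vP] : forall t, exists q : rat, `|ratr q - s' t| <= z / 10.
    by move=> t; exact: rat_approx.
  pose M := (Num.truncn (\sum_t `|x t|)).+1.
  have xM t : `|x t| <= M%:R.
    apply: (@le_trans _ _ (\sum_t `|x t|)); last exact/ltW/truncnS_gt.
    by rewrite (bigD1 t) //= ler_wpDr // sumr_ge0.
  pose q := (finfun u, finfun v, b, M).
  exists (pickle q); rewrite /cover pickleK /piece /= !ffunE.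
  have near_z t : `| `|ratr (u t) - ratr (v t)| - `|s t - s' t| | <= z / 5.
    apply: le_trans (ler_dist_dist _ _) _.
    have -> : ratr (u t) - ratr (v t) - (s t - s' t) = (ratr (u t) - s t) - (ratr (v t) - s' t) :> R by ring.
    apply: le_trans (ler_normB _ _) _; have := uP t; have := vP t; lra.
  have := near_z b; rewrite -/z ler_norml => /andP[h1 h2].
  split=> //.
  - lra.
  - move=> t; rewrite !ffunE; have := near_z t; rewrite ler_norml => /andP[_ h3].
    have := bmax t; lra.
  - exists s, s'; split=> // t; rewrite ffunE distrC.
      by apply: le_trans (uP t) _; lra.
    by apply: le_trans (vP t) _; lra.
apply: box_null_bigcup => i; rewrite /cover; case: unpickle => //.
by apply: (@lipschitz_graph_null _ t0 0 0).
Qed.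

End NullSets.

(** * Evaluation and Bernstein polynomials *)

Section Evaluation.
Context {R : realType} {n : nat}.
Local Notation poly := (mpoly n R).
Local Notation pt := (n.-tuple R).
Implicit Types (p q : poly) (u : pt).

Definition in_box u := forall i, -1 <= tnth u i <= 1.

Definition coef_norm p : R := \sum_(m <- msupp p) `|mcoeff m p|.

Lemma coef_norm_ge0 p : 0 <= coef_norm p.
Proof. exact: sumr_ge0. Qed.

Lemma mono_eval_box al u : in_box u -> `|mono_eval al u| <= 1.
Proof.
move=> bu; rewrite normr_prod; apply: prodr_ile1 => i _.
by rewrite normr_ge0 normrX exprn_ile1 // ler_norml bu.
Qed.

Lemma pevalE p u : peval p u = \sum_(m <- msupp p) mcoeff m p * mono_eval m u.
Proof. exact: mevalE. Qed.

Lemma peval_box p u : in_box u -> `|peval p u| <= coef_norm p.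
Proof.
move=> bu; rewrite pevalE; apply: le_trans (ler_norm_sum _ _ _) _.
apply: ler_sum => m _; rewrite normrM ler_piMr //; exact: mono_eval_box.
Qed.

Lemma mono_eval_cvg (I : Type) (F : set_system I) {FF : Filter F} (u : I -> pt) (v : pt) al :
  (forall i, (fun k => tnth (u k) i) @ F --> tnth v i) ->
  (fun k => mono_eval al (u k)) @ F --> mono_eval al v.
Proof. by move=> uv; apply: cvg_prodr => i; exact: cvg_exprn. Qed.

Lemma peval_cvg (I : Type) (F : set_system I) {FF : Filter F} (u : I -> pt) (v : pt) p :
  (forall i, (fun k => tnth (u k) i) @ F --> tnth v i) ->
  (fun k => peval p (u k)) @ F --> peval p v.
Proof.
move=> uv; rewrite pevalE; under eq_fun do rewrite pevalE.
by apply: cvg_sumr => m; apply: cvgM; [exact: cvg_cst|exact: mono_eval_cvg].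
Qed.

Lemma box_ultralim (I : Type) (U : set_system I) {UU : UltraFilter U} (u : I -> pt) :
  (forall k, in_box (u k)) ->
  exists v : pt, forall i, (fun k => tnth (u k) i) @ U --> tnth v i.
Proof.
move=> bu; have /choice[v vP] : forall i, exists l : R, (fun k => tnth (u k) i) @ U --> l.
  move=> i; apply: (@ultra_bounded_cvg _ _ _ _ _ 1).
  by apply: filterE => k /=; rewrite ler_norml bu.
by exists [tuple v i | i < n] => i; rewrite tnth_mktuple.
Qed.

Lemma peval_sphere u : peval sphere_poly u = \sum_(i < n) tnth u i ^+ 2 - 1.
Proof.
rewrite /peval /sphere_poly mevalB meval1 raddf_sum /=; congr (_ - _).
by apply: eq_bigr => i _; rewrite rmorphXn /= mevalXU.
Qed.

End Evaluation.

(** * Bernstein operators on the box *)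

Section Bernstein.
Context {R : realType} {n : nat}.
Local Notation poly := (mpoly n R).
Local Notation pt := (n.-tuple R).
Local Notation Xv i := (mpolyX R (mnm1 i) : poly).

(** The extra factor [p] avoids the exponent [k - 1] and a separate case [k = 0]. *)
Lemma mderivXn_mul (i : 'I_n) (p : poly) k :
  p * mderiv i (p ^+ k) = k%:R *: (p ^+ k * mderiv i p).
Proof.
elim: k => [|k IHk]; first by rewrite expr0 mderivC mulr0 scale0r.
rewrite exprS mderivM mulrDr IHk -!mul_mpolyC -natr1 mpolyCD mpolyC1.
by ring.
Qed.

Lemma mderivXU (i j : 'I_n) : mderiv i (Xv j) = (i == j)%:R.
Proof.
rewrite mderivX mnm1E eq_sym; case: eqP => [->|_]; last by rewrite scale0r.
by rewrite scale1r -{1}[mnm1 j]add0m addmK mpolyX0.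
Qed.

(** The Bernstein basis of [0, 1] transported to [-1, 1] by [x = 2 y - 1]; [bnode] is the image of
    the node [j / N]. *)
Definition bernstein N (i : 'I_n) (j : 'I_N.+1) : poly :=
  ('C(N, j)%:R / 2 ^+ N) *: ((1 + Xv i) ^+ j * (1 - Xv i) ^+ (N - j)).

Definition bnode N (j : 'I_N.+1) : R := j%:R * 2 / N%:R - 1.

Definition bgrid N (J : {ffun 'I_n -> 'I_N.+1}) : pt := [tuple bnode (J i) | i < n].

Definition bweight N (J : {ffun 'I_n -> 'I_N.+1}) : poly := \prod_i bernstein i (J i).

Lemma mderiv_prod_eq0 (i : 'I_n) (I : Type) (s : seq I) (P : pred I) (f : I -> poly) :
  (forall k, P k -> mderiv i (f k) = 0) -> mderiv i (\prod_(k <- s | P k) f k) = 0.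
Proof.
move=> f0; elim/big_rec: _ => [|k p Pk IHp]; first exact: mderivC.
by rewrite mderivM f0 // IHp mul0r mulr0 addr0.
Qed.

Lemma mderiv_bernstein_neq N (i k : 'I_n) (j : 'I_N.+1) : k != i ->
  mderiv i (bernstein k j) = 0.
Proof.
move=> ki; rewrite mderivZ mderivM.
have pow0 (p : poly) l : mderiv i p = 0 -> mderiv i (p ^+ l) = 0.
  move=> p0; elim: l => [|l IHl]; first by rewrite expr0 mderivC.
  by rewrite exprS mderivM p0 IHl mul0r mulr0 addr0.
have Xk : mderiv i (Xv k) = 0 by rewrite mderivXU eq_sym (negPf ki).
by rewrite !pow0 ?mulr0 ?mul0r ?addr0 ?scaler0 // ?mderivB ?mderivD Xk mderivC ?subrr ?addr0.
Qed.

(** The logarithmic derivative of the basis element, multiplied by [1 - x^2], is [j (1 - x) - (N -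
    j) (1 + x) = N (bnode j - x)]. Multiplication by the node thus becomes a differential operator
    that does not depend on [j]. *)
Lemma mderiv_bernstein N (i : 'I_n) (j : 'I_N.+1) : (0 < N)%N ->
  bnode j *: bernstein i j =
  Xv i * bernstein i j + N%:R^-1 *: ((1 - Xv i ^+ 2) * mderiv i (bernstein i j)).
Proof.
move=> N0; rewrite /bernstein; move: ('C(N, j)%:R / 2 ^+ N) => c; set l := (N - j)%N.
have jl : (j + l = N)%N by rewrite subnKC // -ltnS.
rewrite mderivZ -!scalerAr !scalerA [N%:R^-1 * c]mulrC [bnode j * c]mulrC -!scalerA.
rewrite -scalerDr; congr (_ *: _).
have dP : mderiv i (1 + Xv i) = 1 by rewrite mderivD mderivC add0r mderivXU eqxx.
have dM : mderiv i (1 - Xv i) = -1 by rewrite mderivB mderivC sub0r mderivXU eqxx.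
have hP := mderivXn_mul i (1 + Xv i) j; have hM := mderivXn_mul i (1 - Xv i) l.
rewrite dP mulr1 in hP; rewrite dM mulrN1 in hM.
rewrite mderivM.
set P := (1 + Xv i) ^+ j in hP *; set M := (1 - Xv i) ^+ l in hM *.
have -> : (1 - Xv i ^+ 2) * (mderiv i P * M + P * mderiv i M) =
    (1 - Xv i) * M * ((1 + Xv i) * mderiv i P) + (1 + Xv i) * P * ((1 - Xv i) * mderiv i M).
  by ring.
rewrite hP hM scalerN -!mul_mpolyC.
have N0' : N%:R != 0 :> R by rewrite pnatr_eq0 -lt0n.
have -> : bnode j = N%:R^-1 * (j%:R - l%:R).
  have -> : l%:R = N%:R - j%:R :> R by rewrite natrB // -ltnS.
  by rewrite /bnode; field.
have N1 : (N%:R^-1)%:MP_[n] * (j%:R%:MP + l%:R%:MP) = 1 :> poly.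
  by rewrite -mpolyCD -natrD jl -mpolyCM mulVf // mpolyC1.
rewrite mpolyCM mpolyCB.
apply/eqP; rewrite -subr_eq0; apply/eqP.
transitivity ((Xv i * (P * M)) * ((N%:R^-1)%:MP_[n] * (j%:R%:MP + l%:R%:MP) - 1)); last first.
  by rewrite N1 subrr mulr0.
by ring.
Qed.

Lemma mderiv_bweight N (J : {ffun 'I_n -> 'I_N.+1}) (i : 'I_n) : (0 < N)%N ->
  bnode (J i) *: bweight J =
  Xv i * bweight J + N%:R^-1 *: ((1 - Xv i ^+ 2) * mderiv i (bweight J)).
Proof.
move=> N0; rewrite /bweight (bigD1 i) //= scalerAl mderiv_bernstein // mderivM.
rewrite [X in _ + _ * X]mderiv_prod_eq0; last by move=> k ki; exact: mderiv_bernstein_neq.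
by rewrite mulr0 addr0 mulrDl mulrA -scalerAl mulrA.
Qed.

Lemma sum_bweight N : \sum_(J : {ffun 'I_n -> 'I_N.+1}) bweight J = 1.
Proof.
rewrite -(bigA_distr_bigA (fun (i : 'I_n) (j : 'I_N.+1) => bernstein i j)) /=.
apply: big1 => i _; rewrite /bernstein.
have e : (1 - Xv i) + (1 + Xv i) = (2 : R)%:MP by rewrite -[2]/(1 + 1) mpolyCD mpolyC1; ring.
transitivity ((2 ^+ N)^-1 *: ((1 - Xv i) + (1 + Xv i)) ^+ N).
  rewrite (exprDn (1 - Xv i)) scaler_sumr; apply: eq_bigr => j _.
  by rewrite mulrC -scalerA [_ * (1 - _) ^+ _]mulrC scaler_nat.
have -> : ((1 - Xv i) + (1 + Xv i)) ^+ N = (2 ^+ N : R)%:MP by rewrite e rmorphXn.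
by rewrite -mul_mpolyC -mpolyCM mulVf ?mpolyC1 // expf_neq0.
Qed.

(* [s.[N^-1]] is the Bernstein operator of degree [N] applied to [p]; it is
   polynomial in [N^-1], with value [p] at [0]. *)
Definition bernstein_approx (p : poly) := exists s : {poly poly}, s.[0] = p /\
  forall N, (0 < N)%N -> s.[(N%:R^-1)%:MP] =
    \sum_(J : {ffun 'I_n -> 'I_N.+1}) peval p (bgrid J) *: bweight J.

Lemma bernstein_approx1 : bernstein_approx 1.
Proof.
exists 1%:P; split=> [|N _]; rewrite hornerC // -[LHS](sum_bweight N).
by apply: eq_bigr => J _; rewrite /peval meval1 scale1r.
Qed.

Lemma bernstein_approxD p q : bernstein_approx p -> bernstein_approx q ->
  bernstein_approx (p + q).
Proof.
move=> [s [s0 sN]] [t [t0 tN]]; exists (s + t); split=> [|N N0].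
  by rewrite hornerD s0 t0.
rewrite hornerD sN // tN // -big_split; apply: eq_bigr => J _ /=.
by rewrite /peval mevalD scalerDl.
Qed.

Lemma bernstein_approxZ c p : bernstein_approx p -> bernstein_approx (c *: p).
Proof.
move=> [s [s0 sN]]; exists (c%:MP *: s); split=> [|N N0].
  by rewrite hornerZ s0 mul_mpolyC.
rewrite hornerZ sN // mul_mpolyC scaler_sumr; apply: eq_bigr => J _ /=.
by rewrite /peval mevalZ scalerA.
Qed.

Lemma horner_mderiv (i : 'I_n) (s : {poly poly}) :
  exists s', forall h : R, s'.[h%:MP] = mderiv i s.[h%:MP].
Proof.
elim/poly_ind: s => [|s c [s' s'P]]; first by exists 0 => h; rewrite !horner0 mderiv0.
exists (s' * 'X + (mderiv i c)%:P) => h.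
by rewrite !hornerMXaddC mderivD mderivM mderivC mulr0 addr0 s'P.
Qed.

Lemma bernstein_approxX (i : 'I_n) p : bernstein_approx p -> bernstein_approx (Xv i * p).
Proof.
move=> [s [s0 sN]]; have [s' s'P] := horner_mderiv i s.
(* By [mderiv_bweight], passing from [p] to [x_i p] applies this operator to the Bernstein sum; the
   variable ['X] stands for [N^-1], so the second term vanishes at 0. *)
exists (Xv i *: s + 'X * ((1 - Xv i ^+ 2) *: s')); split=> [|N N0].
  by rewrite hornerD hornerZ s0 hornerM hornerX mul0r addr0.
rewrite hornerD hornerZ hornerM hornerX hornerZ s'P sN // mul_mpolyC.
rewrite raddf_sum !mulr_sumr scaler_sumr -big_split; apply: eq_bigr => J _ /=.
rewrite mderivZ -!scalerAr scalerA [_ * peval _ _]mulrC -scalerA -scalerDr.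
rewrite -mderiv_bweight // scalerA; congr (_ *: _).
by rewrite /peval mevalM mevalXU mulrC tnth_mktuple.
Qed.

Lemma bernstein_approx_all p : bernstein_approx p.
Proof.
elim/mpolyind: p => [|c m p _ _ IHp].
  by rewrite -(scale0r 1); apply: bernstein_approxZ; exact: bernstein_approx1.
apply: bernstein_approxD => //; apply: bernstein_approxZ.
rewrite mpolyXE_id; elim/big_rec: _ => [|i q _ IHq]; first exact: bernstein_approx1.
elim: (m i) => [|k IHk]; first by rewrite expr0 mul1r.
by rewrite exprS -mulrA; exact: bernstein_approxX.
Qed.

Lemma bgrid_box N (J : {ffun 'I_n -> 'I_N.+1}) : (0 < N)%N -> in_box (bgrid J).
Proof.
move=> N0 i; rewrite tnth_mktuple /bnode.
have jN : (J i)%:R <= N%:R :> R by rewrite ler_nat -ltnS.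
have N0' : 0 < N%:R :> R by rewrite ltr0n.
have h1 : 0 <= (J i)%:R * 2 / N%:R :> R by rewrite divr_ge0 // mulr_ge0.
have h2 : (J i)%:R * 2 / N%:R <= 2 :> R by rewrite ler_pdivrMr // mulrC ler_wpM2l.
by apply/andP; split; lra.
Qed.

End Bernstein.

(** * Positive functionals on polynomials *)

Section PositiveFunctional.
Context {R : realType} {n : nat}.
Local Notation poly := (mpoly n R).
Local Notation pt := (n.-tuple R).
Local Notation Xv i := (mpolyX R (mnm1 i) : poly).
Variable L : poly -> R.
Hypotheses (LD : forall p q, L (p + q) = L p + L q)
  (LZ : forall c p, L (c *: p) = c * L p).

Definition square_positive p := forall q, 0 <= L (q ^+ 2 * p).
Definition ideal_null p := forall q, L (q * p) = 0.

Let L0 : L 0 = 0. Proof. by rewrite -(scale0r 0) LZ mul0r. Qed.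

Let L_sum (I : Type) (s : seq I) (P : pred I) (f : I -> poly) :
  L (\sum_(i <- s | P i) f i) = \sum_(i <- s | P i) L (f i).
Proof. exact: (big_morph L LD L0). Qed.

Let LB p q : L (p - q) = L p - L q.
Proof. by rewrite -scaleN1r LD LZ mulN1r. Qed.

Hypothesis L1 : square_positive 1.
Hypothesis Lsphere : ideal_null sphere_poly.

(* Modulo the sphere, [2 (1 + c x_i) = (1 + c x_i)^2 + \sum_(j <> i) x_j^2]. *)
Lemma square_positive_affine p (i : 'I_n) (c : R) : c ^+ 2 = 1 ->
  square_positive p -> square_positive (p * (1 + c *: Xv i)).
Proof.
move=> c2 pp q.
have e : 2%:R *: (1 + c *: Xv i) = (1 + c *: Xv i) ^+ 2 + \sum_(j < n | j != i) Xv j ^+ 2 - sphere_poly.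
  rewrite /sphere_poly [\sum_(_ < _) _](bigD1 i) //= -!mul_mpolyC mpolyC_nat.
  have c2' : c%:MP_[n] ^+ 2 = 1 :> poly by rewrite -rmorphXn /= c2 mpolyC1.
  set S := \sum_(_ < _ | _) _.
  transitivity (1 + 2%:R * (c%:MP * Xv i) + c%:MP_[n] ^+ 2 * Xv i ^+ 2 + S - (Xv i ^+ 2 + S - 1)); last by ring.
  by rewrite c2'; ring.
have : 0 <= L (q ^+ 2 * (p * (2%:R *: (1 + c *: Xv i)))).
  rewrite e; set A := (1 + _) ^+ 2; set S := \sum_(_ < _ | _) _.
  have -> : q ^+ 2 * (p * (A + S - sphere_poly)) =
      q ^+ 2 * (p * A) + q ^+ 2 * (p * S) - q ^+ 2 * p * sphere_poly by ring.
  rewrite LB Lsphere subr0 LD addr_ge0 //.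
    by rewrite mulrCA -exprMn mulrC.
  rewrite !mulr_sumr L_sum; apply: sumr_ge0 => j _.
  by rewrite mulrCA -exprMn mulrC.
by rewrite -!scalerAr LZ pmulr_rge0.
Qed.

Lemma square_positive_bweight N (J : {ffun 'I_n -> 'I_N.+1}) : square_positive (bweight J).
Proof.
rewrite /bweight; elim/big_rec: _ => [|i p _ IHp]; first exact: L1.
rewrite mulrC /bernstein -scalerAr => q; rewrite -scalerAr LZ mulr_ge0 //.
move: q; rewrite -/(square_positive _) mulrA.
have pow c k r : c ^+ 2 = 1 -> square_positive r ->
    square_positive (r * (1 + c *: Xv i) ^+ k).
  move=> c2 rp; elim: k => [|k IHk]; first by rewrite expr0 mulr1.
  by rewrite exprSr mulrA; exact: square_positive_affine.
have := pow 1 (J i : nat) p (expr1n _ _) IHp; rewrite scale1r => h.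
have := pow (-1) (N - J i)%N _ _ h; rewrite scaleN1r; apply.
by rewrite sqrrN expr1n.
Qed.

(** By linearity, [L] of the value of [s] at a constant [h] is a real polynomial in [h], so no
    topology on polynomials is involved. *)
Lemma functional_horner_cvg (s : {poly poly}) :
  (fun N : nat => L s.[(N.+1%:R^-1)%:MP]) @ \oo --> L s.[0].
Proof.
elim/poly_ind: s => [|s c IHs].
  by under eq_fun do rewrite horner0; rewrite horner0; exact: cvg_cst.
rewrite hornerMXaddC mulr0 add0r.
rewrite [X in X @ _](_ : _ = fun N : nat => N.+1%:R^-1 * L s.[(N.+1%:R^-1)%:MP] + L c).
  rewrite -[X in _ --> X]add0r -[X in _ --> X + _](mul0r (L s.[0])).
  apply: cvgD; last exact: cvg_cst.
  by apply: cvgM IHs; exact: cvg_harmonic.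
by apply: funext => N; rewrite hornerMXaddC LD mulrC mul_mpolyC LZ.
Qed.

(** The Bernstein sums of [p] are combinations of the [bweight J] with nonnegative coefficients, and
    [L p] is the limit of the values of [L] on them. *)
Lemma functional_ge0_box p : (forall u, in_box u -> 0 <= peval p u) -> 0 <= L p.
Proof.
move=> p0; have [s [s0 sN]] := bernstein_approx_all p.
rewrite -s0; apply: cvgr_to_ge (@functional_horner_cvg s) _.
apply: filterE => N /=; rewrite sN // L_sum; apply: sumr_ge0 => J _.
rewrite LZ mulr_ge0 //; first exact/p0/bgrid_box.
by have := square_positive_bweight J 1; rewrite expr1n mul1r.
Qed.

End PositiveFunctional.

(** * Putinar's Positivstellensatz for functionals *)

Section Putinar.
Context {R : realType} {n : nat}.
Local Notation poly := (mpoly n R).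
Local Notation pt := (n.-tuple R).

(** If every margin [1 / (k + 1)] failed at some point of the box, a limit of these points would
    satisfy all constraints with [f <= 0]. *)
Lemma compactness_margin (E I : seq poly) (f : poly) :
  (forall u, in_box u -> (forall e, e \in E -> peval e u = 0) ->
     (forall g, g \in I -> 0 <= peval g u) -> 0 < peval f u) ->
  exists2 d : R, 0 < d & forall u, in_box u ->
    (forall e, e \in E -> `|peval e u| <= d) ->
    (forall g, g \in I -> - d <= peval g u) -> d <= peval f u.
Proof.
move=> fpos; apply: contrapT => nd.
have /choice[u uP] : forall k : nat, exists u, [/\ in_box u,
    forall e, e \in E -> `|peval e u| <= k.+1%:R^-1,
    forall g, g \in I -> - k.+1%:R^-1 <= peval g u & peval f u <= k.+1%:R^-1].
  move=> k; apply: contrapT => nu; apply: nd.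
  exists k.+1%:R^-1 => [|u bu Eu Iu]; first by rewrite invr_gt0 ltr0n.
  by rewrite leNgt; apply/negP => /ltW fu; apply: nu; exists u.
have [U [UU Uoo]] := free_ultrafilter.
have [k|v uv] := box_ultralim (U := U) (u := u); first by have [] := uP k.
have inv0 : (fun k : nat => k.+1%:R^-1 : R) @ U --> (0 : R) by exact: cvg_free_inv.
have bv : in_box v.
  move=> i; apply/andP; split.
    by apply: cvgr_to_ge (uv i) _; apply: filterE => k /=; have [/(_ i)/andP[]] := uP k.
  by apply: cvgr_to_le (uv i) _; apply: filterE => k /=; have [/(_ i)/andP[]] := uP k.
have : peval f v <= 0.
  by apply: (ler_cvg_to (peval_cvg (p := f) uv) inv0); apply: filterE => k; have [] := uP k.
apply/negP; rewrite -ltNge; apply: fpos => // [e eE|g gI].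
  apply/eqP; rewrite -normr_le0.
  apply: (ler_cvg_to (cvg_norm (peval_cvg (p := e) uv)) inv0).
  by apply: filterE => k; have [_ + _ _] := uP k; apply.
have ninv0 : (fun k : nat => - k.+1%:R^-1 : R) @ U --> (0 : R).
  by rewrite -oppr0; exact: cvgN.
apply: (ler_cvg_to ninv0 (peval_cvg (p := g) uv)).
by apply: filterE => k; have [_ _ + _] := uP k; apply.
Qed.

(** Inductive step: [(1 + (k + 1) x) (1 - x) <= 1 + k x]. It yields the uniform bound
    [k x (1 - x)^k <= 1]. *)
Lemma damped_bernoulli (x : R) k : 0 <= x <= 1 -> (1 + k%:R * x) * (1 - x) ^+ k <= 1.
Proof.
case/andP=> x0 x1; elim: k => [|k IHk]; first by rewrite mul0r addr0 mul1r expr0.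
apply: le_trans IHk; rewrite exprS mulrA ler_wpM2r ?exprn_ge0 ?subr_ge0 //.
by rewrite -natr1; have : 0 <= k%:R :> R := ler0n _ _; nra.
Qed.

(** The scaling brings [g] into [-1, 1] on the box. Where [g] is nonnegative [damped_bernoulli]
    applies; where it is negative the even power keeps the product nonpositive. *)
Lemma damped_le k (g : poly) u : in_box u -> (0 < k)%N ->
  (1 - (coef_norm g + 1)^-1 * peval g u) ^+ k.*2 * peval g u
    <= (coef_norm g + 1) / k.*2%:R.
Proof.
move=> bu k0; set C := coef_norm g + 1; set y := peval g u.
have C0 : 0 < C by rewrite ltr_wpDl ?coef_norm_ge0.
have k0' : 0 < k.*2%:R :> R by rewrite ltr0n double_gt0.
have [y0|y0] := leP 0 y; last first.
  apply: (@le_trans _ _ 0); last by rewrite divr_ge0 ?ltW.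
  by apply: mulr_ge0_le0; [rewrite -muln2 exprM sqr_ge0|exact: ltW].
pose x := C^-1 * y; have yE : y = C * x by rewrite mulrA mulfV ?mul1r // gt_eqF.
have x1 : x <= 1.
  rewrite /x mulrC ler_pdivrMr // mul1r; apply: le_trans (ler_norm _) _.
  by apply: le_trans (peval_box g bu) _; rewrite lerDl.
have x01 : 0 <= x <= 1 by rewrite x1 andbT /x mulr_ge0 // invr_ge0 ltW.
rewrite -/x yE ler_pdivlMr //.
have := damped_bernoulli k.*2 x01; set w := (1 - x) ^+ _ => h.
have w0 : 0 <= w by rewrite /w exprn_ge0 // subr_ge0.
have -> : w * (C * x) * k.*2%:R = C * ((1 + k.*2%:R * x) * w - w) by ring.
rewrite -[X in _ <= X]mulr1; apply: ler_wpM2l; first exact: ltW.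
by lra.
Qed.

(** Where [g] is negative the damping factor is at least 1, so violations are not weakened. *)
Lemma damped_le_neg k (g : poly) u (d : R) : 0 <= d -> peval g u <= - d ->
  (1 - (coef_norm g + 1)^-1 * peval g u) ^+ k.*2 * peval g u <= - d.
Proof.
move=> d0 gd; set w := _ ^+ _.
have C0 : 0 < coef_norm g + 1 by rewrite ltr_wpDl ?coef_norm_ge0.
have w1 : 1 <= w.
  rewrite exprn_ege1 // lerBrDr gerDl mulr_ge0_le0 ?invr_ge0 ?(ltW C0) //.
  by lra.
nra.
Qed.

(* Putinar's Positivstellensatz in dual form: the negative part of [f] outside
   the constraint set is compensated by elements of the quadratic module, which
   leaves a polynomial that is nonnegative on the whole box. *)
Lemma putinar_functional (L : poly -> R) (E I : seq poly) (f : poly) :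
  (forall p q, L (p + q) = L p + L q) -> (forall c p, L (c *: p) = c * L p) ->
  square_positive L 1 -> ideal_null L sphere_poly ->
  (forall e, e \in E -> ideal_null L e) ->
  (forall g, g \in I -> square_positive L g) ->
  (forall u, (forall e, e \in E -> peval e u = 0) ->
     (forall g, g \in I -> 0 <= peval g u) -> \sum_(i < n) tnth u i ^+ 2 = 1 ->
     0 < peval f u) ->
  0 <= L f.
Proof.
move=> LD LZ L1 Ls LE LI fpos.
have L0 : L 0 = 0 by rewrite -(scale0r 0) LZ mul0r.
have LS := big_morph L LD L0.
have [|d d0 dP] := @compactness_margin (sphere_poly :: E) I f.
  move=> u bu uE uI; apply: fpos => // [e eE|].
    by apply: uE; rewrite inE eE orbT.
  apply/eqP; rewrite -subr_eq0 -peval_sphere; apply/eqP/uE.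
  by rewrite inE eqxx.
pose A := coef_norm f; have A0 : 0 <= A := coef_norm_ge0 f.
have Ad0 : 0 <= A + d by rewrite addr_ge0 // ltW.
(* [lam] and [mu] are scaled so that a violation of size [d] is worth [A + d], enough to offset
   [f >= - A] and a loss of [d]. *)
have [lam lam0 lamd] : exists2 lam, 0 <= lam & lam * d = A + d.
  by exists ((A + d) / d); rewrite ?divfK ?gt_eqF // divr_ge0 // ltW.
have [mu mu0 mud] : exists2 mu, 0 <= mu & mu * d ^+ 2 = A + d.
  by exists ((A + d) / d ^+ 2); rewrite ?divfK ?expf_neq0 ?gt_eqF // divr_ge0 // sqr_ge0.
pose B := \sum_(g <- I) (coef_norm g + 1).
(* A high damping power limits the loss where the inequalities hold to [d] in total. *)
have [k k0 kP] : exists2 k, (0 < k)%N & lam * (B / k.*2%:R) <= d.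
  exists (Num.truncn (lam * B / d)).+1 => //; set k := _.+1.
  have k0 : 0 < k%:R :> R by rewrite ltr0n.
  have k2 : 0 < k.*2%:R :> R by rewrite ltr0n.
  rewrite mulrA ler_pdivrMr // [d * _]mulrC -ler_pdivrMr // -muln2 natrM.
  apply: (@le_trans _ _ k%:R); first exact/ltW/truncnS_gt.
  by rewrite ler_peMr ?ltW // ltr1n.
pose damp (g : poly) : poly := 1 - (coef_norm g + 1)^-1 *: g.
pose F := f - lam *: (\sum_(g <- I) damp g ^+ k.*2 * g)
  + mu *: (\sum_(e <- sphere_poly :: E) e * e).
have LF : L F = L f - lam * \sum_(g <- I) L (damp g ^+ k.*2 * g).
  rewrite /F !LD -scaleN1r !LZ mulN1r !LS [X in _ + _ * X]big1_seq ?mulr0 ?addr0 //.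
  by move=> e /andP[_]; rewrite inE => /orP[/eqP->|/LE]; [exact: Ls|apply].
have : 0 <= L F.
  apply: functional_ge0_box => // u bu.
  pose h g := (1 - (coef_norm g + 1)^-1 * peval g u) ^+ k.*2 * peval g u.
  have FE : peval F u = peval f u - lam * \sum_(g <- I) h g
      + mu * \sum_(e <- sphere_poly :: E) peval e u ^+ 2.
    rewrite /peval /F mevalD mevalB !mevalZ !raddf_sum /=; congr (_ - _ * _ + _ * _).
      by apply: eq_bigr => g _; rewrite mevalM rmorphXn /= mevalB meval1 mevalZ.
    by apply: eq_bigr => e _; rewrite mevalM expr2.
  have hB (s : seq poly) : \sum_(g <- s) h g <= \sum_(g <- s) (coef_norm g + 1) / k.*2%:R.
    by apply: ler_sum => g _; exact: damped_le.
  have hI : lam * \sum_(g <- I) h g <= d.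
    apply: le_trans kP; rewrite ler_wpM2l // /B mulr_suml; exact: hB.
  have eE0 : 0 <= \sum_(e <- sphere_poly :: E) peval e u ^+ 2.
    by apply: sumr_ge0 => e _; exact: sqr_ge0.
  have fA : - A <= peval f u by have := peval_box f bu; rewrite ler_norml => /andP[].
  rewrite FE.
  (* Three cases: a violated equation is paid for by the [mu] term, a violated inequality by the
     [lam] term, and at nearly feasible points [f >= d] covers the loss. *)
  have [allE|/existsNP[e /not_implyP[eE /negP]]] :=
    pselect (forall e, e \in sphere_poly :: E -> `|peval e u| <= d); last first.
    rewrite -ltNge => ed.
    have : d ^+ 2 <= \sum_(e <- sphere_poly :: E) peval e u ^+ 2.
      rewrite (big_rem e) //= ler_wpDr //; first by apply: sumr_ge0 => ? _; exact: sqr_ge0.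
      by rewrite -[X in _ <= X]real_normK ?num_real // lerXn2r ?nnegrE ?ltW // (lt_trans d0).
    move=> /(ler_wpM2l mu0); rewrite mud => hmu.
    move: hmu hI fA; move: (mu * _) (lam * _) => *; lra.
  have me0 := mulr_ge0 mu0 eE0.
  have [allI|/existsNP[g /not_implyP[gI /negP]]] :=
    pselect (forall g, g \in I -> - d <= peval g u); last first.
    rewrite -ltNge => /ltW /(damped_le_neg k (ltW d0)) gd.
    have : \sum_(g <- I) h g <= B / k.*2%:R - d.
      rewrite /B mulr_suml (big_rem g) //= [X in _ <= X - _](big_rem g) //=.
      have := hB (rem g I); have : 0 <= (coef_norm g + 1) / k.*2%:R.
        by rewrite divr_ge0 // addr_ge0 ?coef_norm_ge0.
      move: gd; rewrite -/(h g); move: (h g) (_ / _) => *; lra.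
    move=> /(ler_wpM2l lam0); rewrite mulrBr lamd => hlam.
    move: hlam kP fA me0; move: (lam * _) (lam * _) (mu * _) => *; lra.
  have := dP u bu allE allI; lra.
rewrite LF subr_ge0; apply: le_trans; apply: mulr_ge0 => //.
rewrite big_seq; apply: sumr_ge0 => g gI.
by rewrite -muln2 exprM; exact: LI.
Qed.

End Putinar.

(** * The pairing and localizing matrices *)

Section Pairing.
Context {R : realType} {n : nat}.
Local Notation poly := (mpoly n R).
Local Notation pt := (n.-tuple R).
Local Notation mvec := (@mvec R n).
Implicit Types (p q : poly) (z : mvec).

Lemma pdeg_msize p t : (pdeg p <= t)%N -> (msize p <= t.+1)%N.
Proof.
move=> pt; rewrite msizeE; apply/bigmax_leqP_seq => m mp _; rewrite ltnS.
apply: leq_trans pt; exact: (@leq_bigmax_seq _ (msupp p) xpredT (@mpoly.mdeg n) _ mp).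
Qed.

Lemma pairing_msize k p z : (msize p <= k)%N ->
  pairing p z = \sum_(al : bmultinom n k) mcoeff al p * z al.
Proof.
move=> lt_pk; pose I : subFinType _ := bmultinom n k.
rewrite /pairing (big_mksub I) //=; first last.
- by move=> x /msize_mdeg_lt /leq_trans; apply.
- by rewrite msupp_uniq.
by rewrite big_rmcond //= => i; move/memN_msupp_eq0 ->; rewrite mul0r.
Qed.

Lemma pairingD z p q : pairing (p + q) z = pairing p z + pairing q z.
Proof.
pose k := (maxn (msize (p + q)) (maxn (msize p) (msize q))).
rewrite !(@pairing_msize k) ?leq_max ?leqnn ?orbT //.
by rewrite -big_split; apply: eq_bigr => al _ /=; rewrite mcoeffD mulrDl.
Qed.

Lemma pairingZ z c p : pairing (c *: p) z = c * pairing p z.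
Proof.
pose k := maxn (msize (c *: p)) (msize p).
rewrite !(@pairing_msize k) ?leq_max ?leqnn ?orbT //.
by rewrite mulr_sumr; apply: eq_bigr => al _ /=; rewrite mcoeffZ mulrA.
Qed.

Lemma pairing0 z : pairing 0 z = 0.
Proof. by rewrite -(scale0r 0) pairingZ mul0r. Qed.

Lemma pairing_sum (I : Type) (s : seq I) (P : pred I) (f : I -> poly) z :
  pairing (\sum_(i <- s | P i) f i) z = \sum_(i <- s | P i) pairing (f i) z.
Proof. exact: (big_morph (fun p => pairing p z) (pairingD z) (pairing0 z)). Qed.

Lemma pairingX al z : pairing (mpolyX R al) z = z al.
Proof. by rewrite /pairing msuppX big_seq1 mcoeffX eqxx mul1r. Qed.

Lemma pairing_loc_entry q z al be :
  pairing (mpolyX R al * mpolyX R be * q) z = loc_entry q z al be.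
Proof.
rewrite {1}[q]mpolyE mulr_sumr pairing_sum; apply: eq_bigr => ga _.
by rewrite -scalerAr pairingZ -!mpolyXD pairingX.
Qed.

Lemma pairing_localize k p q g z : (msize p <= k)%N -> (msize q <= k)%N ->
  pairing (p * q * g) z = \sum_(al : bmultinom n k) \sum_(be : bmultinom n k)
    mcoeff al p * mcoeff be q * loc_entry g z al be.
Proof.
move=> pk qk; rewrite {1}[p](mpolywE pk) {1}[q](mpolywE qk) !mulr_suml pairing_sum.
apply: eq_bigr => al _; rewrite mulr_sumr mulr_suml pairing_sum; apply: eq_bigr => be _.
by rewrite -scalerAl -scalerAr scalerA -scalerAl pairingZ pairing_loc_entry.
Qed.

Lemma loc_psd_pairing k q g z : (msize q <= (loc_size k g).+1)%N -> loc_psd k g z ->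
  0 <= pairing (q ^+ 2 * g) z.
Proof.
move=> qk /(_ (fun al => mcoeff al q)).
by rewrite expr2 (pairing_localize _ _ qk qk).
Qed.

Lemma loc_zero_pairing k q e z : (msize q <= (loc_size k e).+1)%N -> loc_zero k e z ->
  pairing (q * e) z = 0.
Proof.
move=> qk ez; rewrite -[q]mulr1 (@pairing_localize (loc_size k e).+1) //.
  apply: big1 => al _; apply: big1 => be _.
  by rewrite ez ?mulr0 // -ltnS; exact: bmdeg.
by rewrite msize1.
Qed.

(** The moments, in all degrees, of the measure with mass [lam j] at [u j]; one vector thus serves
    relaxations of every order. *)
Definition atomic r (lam : 'I_r -> R) (u : 'I_r -> pt) : mvec :=
  fun al => \sum_j lam j * mono_eval al (u j).

Lemma pairing_atomic r (lam : 'I_r -> R) (u : 'I_r -> pt) p :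
  pairing p (atomic lam u) = \sum_j lam j * peval p (u j).
Proof.
rewrite /pairing /atomic; under eq_bigr do rewrite mulr_sumr.
rewrite exchange_big; apply: eq_bigr => j _; rewrite pevalE mulr_sumr.
by apply: eq_bigr => al _; rewrite mulrCA.
Qed.

Lemma peval_mpolyX al (u : pt) : peval (mpolyX R al) u = mono_eval al u.
Proof. exact: mevalX. Qed.

Lemma loc_entry_atomic r (lam : 'I_r -> R) (u : 'I_r -> pt) q al be :
  loc_entry q (atomic lam u) al be =
  \sum_j lam j * (mono_eval al (u j) * mono_eval be (u j) * peval q (u j)).
Proof.
rewrite -pairing_loc_entry pairing_atomic; apply: eq_bigr => j _.
by rewrite -!peval_mpolyX /peval !mevalM.
Qed.

Lemma loc_zero_atomic r (lam : 'I_r -> R) (u : 'I_r -> pt) q k :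
  (forall j, peval q (u j) = 0) -> loc_zero k q (atomic lam u).
Proof.
move=> q0 al be _ _; rewrite loc_entry_atomic big1 // => j _.
by rewrite q0 !mulr0.
Qed.

Lemma loc_psd_atomic r (lam : 'I_r -> R) (u : 'I_r -> pt) q k :
  (forall j, 0 <= lam j) -> (forall j, 0 <= peval q (u j)) -> loc_psd k q (atomic lam u).
Proof.
move=> lam0 q0 v.
suff -> : \sum_(al : bmultinom n (loc_size k q).+1) \sum_(be : bmultinom n (loc_size k q).+1)
    v al * v be * loc_entry q (atomic lam u) al be =
    \sum_j lam j * peval q (u j) *
      (\sum_(al : bmultinom n (loc_size k q).+1) v al * mono_eval al (u j)) ^+ 2.
  by apply: sumr_ge0 => j _; apply: mulr_ge0; [exact: mulr_ge0|exact: sqr_ge0].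
under eq_bigr do under eq_bigr do rewrite loc_entry_atomic mulr_sumr.
under eq_bigr do rewrite exchange_big.
rewrite exchange_big; apply: eq_bigr => j _ /=; move: (peval q (u j)) => y.
rewrite expr2 mulr_suml mulr_sumr; apply: eq_bigr => al _.
rewrite !mulr_sumr; apply: eq_bigr => be _.
by ring.
Qed.

Lemma atomic_sdp_feasible (cE cI : seq poly) m (g : 'I_m -> poly) (a : 'I_m -> R) k
    r (lam : 'I_r -> R) (u : 'I_r -> pt) :
  (forall j, 0 <= lam j) -> (forall j, Kcirc cE cI (u j)) ->
  (forall i, pairing (g i) (atomic lam u) <= a i) ->
  sdp_feasible cE cI g a k (atomic lam u).
Proof.
move=> lam0 Ku ga; split=> //; split=> [c cE'|].
  by apply: loc_zero_atomic => j; have [/(_ _ cE')] := Ku j.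
split=> [c cI'|].
  by apply: loc_psd_atomic => // j; have [_ [/(_ _ cI')]] := Ku j.
split.
  by apply: loc_zero_atomic => j; have [_ [_ s1]] := Ku j; rewrite peval_sphere s1 subrr.
by apply: loc_psd_atomic => // j; rewrite /peval meval1.
Qed.

Lemma Kcirc_box (cE cI : seq poly) u : Kcirc cE cI u -> in_box u.
Proof.
move=> [_ [_ s1]] i; rewrite -ler_norml -(@ler_pXn2r _ 2) ?nnegrE // expr1n real_normK ?num_real //.
by rewrite -s1 (bigD1 i) //= ler_wpDr // sumr_ge0 // => j _; exact: sqr_ge0.
Qed.

Lemma Kcirc_ultraclosed (cE cI : seq poly) (I : Type) (U : set_system I)
    {UU : UltraFilter U} (u : I -> pt) :
  (forall k, Kcirc cE cI (u k)) ->
  exists2 v, Kcirc cE cI v & forall i, (fun k => tnth (u k) i) @ U --> tnth v i.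
Proof.
move=> Ku; have [k|v uv] := box_ultralim (U := U) (u := u); first exact: Kcirc_box (Ku k).
exists v => //; have cst0 (p : poly) : (forall k, peval p (u k) = 0) -> peval p v = 0.
  move=> p0; apply/eqP; rewrite eq_le; apply/andP; split.
    by apply: cvgr_to_le (peval_cvg (p := p) uv) _; apply: filterE => k; rewrite p0.
  by apply: cvgr_to_ge (peval_cvg (p := p) uv) _; apply: filterE => k; rewrite p0.
split; [|split].
- by move=> c cE'; apply: cst0 => k; have [/(_ _ cE')] := Ku k.
- move=> c cI'; apply: cvgr_to_ge (peval_cvg (p := hom_part c) uv) _.
  by apply: filterE => k; have [_ [/(_ _ cI')]] := Ku k.
- apply/eqP; rewrite -subr_eq0 -peval_sphere cst0 // => k.
  by have [_ [_ s1]] := Ku k; rewrite peval_sphere s1 subrr.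
Qed.

End Pairing.

(** * Moments of measures *)

Section Moments.
Context {R : realType} {n : nat}.
Local Notation poly := (mpoly n R).
Local Notation pt := (n.-tuple R).
Local Notation mvec := (@mvec R n).

Lemma measurable_mono_eval al : measurable_fun [set: pt] (@mono_eval R n al).
Proof.
apply: measurable_prod => i _.
by apply: measurable_funX; exact: measurable_tnth.
Qed.

Lemma measurable_peval (p : poly) : measurable_fun [set: pt] (peval p).
Proof.
rewrite (_ : peval p = fun u => \sum_(m <- msupp p) mcoeff m p * mono_eval m u).
  apply: measurable_sum => m; apply: measurable_funM; first exact: measurable_cst.
  exact: measurable_mono_eval.
by apply: funext => u; exact: pevalE.
Qed.

Lemma measurable_forall_in (I : eqType) (s : seq I) (P : I -> set pt) :
  (forall i, measurable (P i)) -> measurable [set u | forall i, i \in s -> P i u].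
Proof.
move=> mP; elim: s => [|i s IHs].
  by rewrite (_ : [set _ | _] = setT) //; apply/seteqP; split=> u //= _ i; rewrite in_nil.
rewrite (_ : [set _ | _] = P i `&` [set u | forall i, i \in s -> P i u]); first exact: measurableI.
apply/seteqP; split=> [u /= H|u /= [Pi H] j].
  by split=> [|j js]; apply: H; rewrite inE ?eqxx // js orbT.
by rewrite inE => /orP[/eqP->//|/H].
Qed.

Lemma measurable_Kcirc (cE cI : seq poly) : measurable (Kcirc cE cI).
Proof.
have mpre (p : poly) (A : set R) : measurable A -> measurable (peval p @^-1` A).
  by move=> mA; rewrite -[X in measurable X]setTI; exact: measurable_peval.
rewrite (_ : Kcirc cE cI =
  [set u | forall c, c \in cE -> (peval (hom_part c) @^-1` [set 0]) u] `&`
  ([set u | forall c, c \in cI -> (peval (hom_part c) @^-1` `[0, +oo[) u] `&`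
   (peval sphere_poly @^-1` [set 0]))).
  apply: measurableI; first by apply: measurable_forall_in => c; exact: mpre.
  by apply: measurableI; [apply: measurable_forall_in => c|]; exact: mpre.
apply/seteqP; split=> u /= [uE [uI us]]; split=> //; split.
- by move=> c /uI; rewrite in_itv /= andbT.
- by rewrite peval_sphere us subrr.
- by move=> c /uI; rewrite in_itv /= andbT.
- by apply/eqP; rewrite -subr_eq0 -peval_sphere us.
Qed.

Definition moment_vector t (u : pt) : bmultinom n t.+1 -> R := fun al => mono_eval al u.

Definition moment_curve t (K : set pt) := [set moment_vector (t := t) u | u in K].

Definition truncate t (z : mvec) : bmultinom n t.+1 -> R := fun al => z al.

Lemma moment_curve_ultracompact t (cE cI : seq poly) (U : set_system nat) :
  UltraFilter U -> ultracompact U (@moment_curve t (Kcirc cE cI)).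
Proof.
move=> UU x xK.
have /choice[u uP] : forall k, exists u, Kcirc cE cI u /\ moment_vector (t := t) u = x k.
  by move=> k; have [u Ku ux] := xK k; exists u.
have [k|v Kv uv] := @Kcirc_ultraclosed _ _ cE cI _ U _ u; first by have [] := uP k.
exists (moment_vector v); first by exists v.
move=> al; rewrite (_ : (fun k => x k al) = fun k => mono_eval al (u k)).
  exact: mono_eval_cvg.
by apply: funext => k; have [_ <-] := uP k.
Qed.

Lemma bmultinom_of t (al : multinom n) : (mpoly.mdeg al <= t)%N ->
  exists b : bmultinom n t.+1, bmnm b = al.
Proof. by rewrite -ltnS => lt; exists (BMultinom lt). Qed.

Lemma mdeg0_lt t : (mpoly.mdeg (@mnm0 n) < t.+1)%N.
Proof. by rewrite mdeg0. Qed.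

Definition bmnm0 t : bmultinom n t.+1 := BMultinom (mdeg0_lt t).

(** This functional reads off the mass. It is 1 on the moment curve and plays the part of [rho] in
    [cone_separation]. *)
Definition unit_dir t : bmultinom n t.+1 -> R := fun al => (al == bmnm0 t)%:R.

Lemma dot_unit_dir t x : dot (unit_dir (t := t)) x = x (bmnm0 t).
Proof.
rewrite /dot (bigD1 (bmnm0 t)) //= /unit_dir eqxx mul1r big1 ?addr0 //.
by move=> al /negPf ->; rewrite mul0r.
Qed.

Lemma mono_eval0 (u : pt) : mono_eval (@mnm0 n) u = 1.
Proof. by rewrite /mono_eval big1 // => i _; rewrite /mexp mnm0E expr0. Qed.

Lemma unit_dir_curve t (K : set pt) x : @moment_curve t K x -> 1 <= dot (unit_dir (t := t)) x.
Proof. by move=> [u _ <-]; rewrite dot_unit_dir /moment_vector /= mono_eval0. Qed.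

Lemma integral_atomic (r : nat) (lam : nat -> {nonneg R}) (u : nat -> pt) (f : pt -> R) :
  measurable_fun setT f ->
  (\int[msum (fun k => mscale (lam k) (\d_(u k))) r]_x (f x)%:E =
   (\sum_(k < r) (lam k)%:num * f (u k))%:E)%E.
Proof.
move=> mf.
have ge0 (h : pt -> R) : measurable_fun setT h -> (forall x, 0 <= h x) ->
  (\int[msum (fun k => mscale (lam k) (\d_(u k))) r]_x (h x)%:E =
   (\sum_(k < r) (lam k)%:num * h (u k))%:E)%E.
  move=> mh h0.
  have mh' : measurable_fun setT (fun x => (h x)%:E) by exact/measurable_EFinP.
  rewrite ge0_integral_measure_sum //; last by move=> x _; rewrite lee_fin.
  rewrite -sumEFin; apply: eq_bigr => k _.
  rewrite ge0_integral_mscale //; last by move=> x _; rewrite lee_fin.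
  by rewrite integral_dirac // diracT mul1e.
rewrite integralE.
under eq_integral do rewrite funeposE -EFin_max.
under [X in (_ - X)%E]eq_integral do rewrite funenegE -EFinN -EFin_max.
have mP : measurable_fun setT (fun x => Num.max (f x) 0) by apply: measurable_maxr.
have mN : measurable_fun setT (fun x => Num.max (- f x) 0).
  by apply: measurable_maxr => //; exact: measurableT_comp.
have maxr_ge0 (y : R) : 0 <= Num.max y 0 by rewrite le_max lexx orbT.
rewrite (ge0 _ mP) // (ge0 _ mN) // -EFinB -sumrB; congr (_%:E); apply: eq_bigr => k _.
rewrite -mulrBr; congr (_ * _).
by have [h|h] := leP (f (u k)) 0; have [h'|h'] := leP (- f (u k)) 0; lra.
Qed.

Lemma cone_in_Rt t (cE cI : seq poly) (z : mvec) :
  in_cone (@moment_curve t (Kcirc cE cI)) (truncate (t := t) z) ->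
  in_Rt t (Kcirc cE cI) z.
Proof.
move=> [r [lam [x [lam0 [Kx zE]]]]].
have /choice[u uP] : forall j, exists u, Kcirc cE cI u /\ moment_vector (t := t) u = x j.
  by move=> j; have [u Ku ux] := Kx j; exists u.
(* [msum] takes families indexed by [nat]; the default values lie beyond [r] and are not summed. *)
pose lam' k : R := oapp lam 0 (insub k).
have lam'0 k : 0 <= lam' k by rewrite /lam'; case: insub => /=.
pose l k : {nonneg R} := NngNum (lam'0 k).
pose u' k : pt := oapp u [tuple 0 | i < n] (insub k).
exists (msum (fun k => mscale (l k) (\d_(u' k))) r); split.
  split; first exact: measurable_Kcirc.
  rewrite /= /msum big1 // => k _.
  transitivity ((l k)%:num%:E * \d_(u' k) (~` Kcirc cE cI))%E => //.
  rewrite diracE memNset ?mule0 // /u' valK /=.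
  by apply; have [] := uP k.
move=> al alt; rewrite integral_atomic; last exact: measurable_mono_eval.
have [b bal] := bmultinom_of alt; congr (_%:E).
have := zE b; rewrite /truncate bal => ->; apply: eq_bigr => k _.
by rewrite /= /lam' /u' valK /= -(uP k).2 /moment_vector bal.
Qed.

(* Tchakaloff's theorem. *)
Lemma in_Rt_cone t (cE cI : seq poly) (z : mvec) : in_Rt t (Kcirc cE cI) z ->
  in_cone (@moment_curve t (Kcirc cE cI)) (truncate (t := t) z).
Proof.
move=> [mu [[mK muK] zE]]; apply: contrapT => nz.
have [U [UU Uoo]] := free_ultrafilter.
have cK := @moment_curve_ultracompact t cE cI U UU.
have [p pK] := cone_separation UU Uoo cK ltr01 (@unit_dir_curve t (Kcirc cE cI)) nz.
apply/negP; rewrite -leNgt.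
set K := Kcirc cE cI in mK muK zE pK cK nz *.
have mKc : measurable (~` K) by exact: measurableC.
have TK : setT `\` ~` K = K by rewrite setTD setCK.
(* The moment of index 0 is the total mass, so the measure is finite and monomials, bounded by 1 on
   [K], are integrable. *)
have muT : (mu setT < +oo)%E.
  have : (\int[mu]_x (mono_eval (@mnm0 n) x)%:E = (z (@mnm0 n))%:E)%E.
    by apply: zE; rewrite /Defs.mdeg mdeg0.
  under eq_integral do rewrite mono_eval0.
  by rewrite integral_cst // mul1e => ->; rewrite ltry.
have muKoo : (mu K < +oo)%E by apply: le_lt_trans muT; apply: le_measure; rewrite ?inE.
have intK al : mu.-integrable K (fun x => (mono_eval al x)%:E).
  apply: measurable_bounded_integrable => //.
    by apply: measurable_funTS; exact: measurable_mono_eval.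
  exists 1; split; first exact: num_real.
  move=> M M1 x Kx; apply: le_trans (ltW M1); apply: mono_eval_box.
  exact: Kcirc_box Kx.
have intT al : mu.-integrable setT (fun x => (mono_eval al x)%:E).
  have mm : measurable_fun setT (fun x => (@mono_eval R n al x)%:E).
    by apply/measurable_EFinP; exact: measurable_mono_eval.
  apply/integrableP; split => //.
  rewrite (@ge0_negligible_integral _ _ _ _ _ (~` K)) // ?TK.
    by have /integrableP[] := intK al.
  by apply: measurableT_comp.
have zK (b : bmultinom n t.+1) : (\int[mu]_(x in K) (mono_eval b x)%:E = (z b)%:E)%E.
  rewrite -zE; last by rewrite -ltnS; exact: bmdeg.
  by rewrite [RHS](@negligible_integral _ _ _ _ _ (~` K)) // TK.
(* Integrating the separating polynomial, nonnegative on [K], gives [dot p z >= 0], against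
   separation. *)
have : (0 <= \int[mu]_(x in K) (dot p (moment_vector x))%:E)%E.
  by apply: integral_ge0 => x Kx; rewrite lee_fin; apply: pK; exists x.
under eq_integral do rewrite /dot -sumEFin.
rewrite integral_sum //; last first.
  move=> b; rewrite /moment_vector.
  under eq_fun do rewrite EFinM.
  exact: integrableZl.
rewrite (eq_bigr (fun b => (p b * z b)%:E)); first by rewrite sumEFin lee_fin.
move=> b _; under eq_integral do rewrite /moment_vector EFinM.
by rewrite integralZl // zK EFinM.
Qed.

End Moments.

(** * Semidefinite relaxations *)

Section Relaxation.
Context {R : realType} {n : nat}.
Local Notation poly := (mpoly n R).
Local Notation pt := (n.-tuple R).
Local Notation mvec := (@mvec R n).

Definition coefs t (p : poly) : bmultinom n t.+1 -> R := fun al => mcoeff al p.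

Lemma pairing_dot t (p : poly) (z : mvec) : (pdeg p <= t)%N ->
  pairing p z = dot (coefs (t := t) p) (truncate z).
Proof. by move=> /pdeg_msize/pairing_msize ->. Qed.

Lemma peval_dot t (p : poly) (u : pt) : (pdeg p <= t)%N ->
  dot (coefs (t := t) p) (moment_vector u) = peval p u.
Proof.
move=> pt; rewrite pevalE -[RHS]/(pairing p (fun al => mono_eval al u)).
by rewrite (pairing_dot _ pt).
Qed.

Lemma in_cone_atomic t (K : set pt) (z : mvec) :
  in_cone (@moment_curve R n t K) (truncate (t := t) z) ->
  exists r (lam : 'I_r -> R) (u : 'I_r -> pt), [/\ forall j, 0 <= lam j,
    forall j, K (u j) & truncate (t := t) z = truncate (atomic lam u)].
Proof.
move=> [r [lam [x [lam0 [Kx zE]]]]].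
have /choice[u uP] : forall j, exists u, K u /\ moment_vector (t := t) u = x j.
  by move=> j; have [u Ku ux] := Kx j; exists u.
exists r, lam, u; split=> // [j|]; first by have [] := uP j.
by apply: funext => al; rewrite zE; apply: eq_bigr => j _; rewrite -(uP j).2.
Qed.

Lemma atomic_in_cone t (K : set pt) r (lam : 'I_r -> R) (u : 'I_r -> pt) :
  (forall j, 0 <= lam j) -> (forall j, K (u j)) ->
  in_cone (@moment_curve R n t K) (truncate (atomic lam u)).
Proof.
move=> lam0 Ku; exists r, lam, (fun j => moment_vector (u j)); split=> //; split=> //.
by move=> j; exists (u j).
Qed.

Lemma box_null_coef_null t (S : set (bmultinom n t.+1 -> R)) :
  box_null S -> coef_null t [set p : poly | S (coefs p)].
Proof.
move=> nS eps /nS[lo [hi [lohi cov vol]]].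
pose ext (f : bmultinom n t.+1 -> R) (al : multinom n) : R := oapp f 0 (insub al).
have extE f (b : bmultinom n t.+1) : ext f (bmnm b) = f b by rewrite /ext (valK b).
exists (fun j => ext (lo j)), (fun j => ext (hi j)); split; [|split].
- by move=> j al; rewrite /ext; case: insub => /=.
- move=> p /cov[j pj]; exists j => al alt.
  by have [b <-] := bmultinom_of alt; rewrite !extE; exact: pj.
- move=> K; apply: le_lt_trans (vol K); rewrite le_eqVlt; apply/orP; left; apply/eqP.
  by apply: eq_bigr => j _; apply: eq_bigr => b _; rewrite !extE.
Qed.

(** The order lost to the localizing matrix of the sphere. *)
Let c0 := uphalf (pdeg (@sphere_poly R n)).

Lemma loc_psd1_pairing k (q : poly) (z : mvec) : (msize q <= k.+1)%N ->
  loc_psd k 1 z -> 0 <= pairing (q ^+ 2) z.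
Proof.
move=> qk z1; rewrite -[q ^+ 2]mulr1; apply: (loc_psd_pairing _ z1).
rewrite /loc_size (_ : pdeg 1 = 0%N) ?subn0 //.
by rewrite /pdeg msupp1 big_seq1 mdeg0.
Qed.

(* The sphere relation at [be] reads [z_(2 be) = \sum_i z_(2 (be + e_i))] with
   nonnegative summands, so even moments decrease along each coordinate. *)
Lemma even_moment_bound k (z : mvec) al : loc_psd k 1 z -> loc_zero k sphere_poly z ->
  (mpoly.mdeg al <= k - c0)%N -> z (mnm_add al al) <= z (@mnm0 n).
Proof.
move=> z1 zs.
have zpos be : (mpoly.mdeg be <= k)%N -> 0 <= z (mnm_add be be).
  move=> bek; have := loc_psd1_pairing (q := mpolyX R be) _ z1.
  by rewrite expr2 -mpolyXD pairingX; apply; rewrite msizeX.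
move: {2}(mpoly.mdeg al) (erefl (mpoly.mdeg al)) => j; elim: j al => [|j IHj] al alj alk.
  by have -> : al = @mnm0 n by [apply/eqP; rewrite -mdeg_eq0 alj]; rewrite addm0.
have [i ali] : exists i, (0 < al i)%N.
  apply: contrapT => ni; move: alj; rewrite mdegE big1 // => i _.
  by case: (posnP (al i)) => // ali; exfalso; apply: ni; exists i.
pose be := mnm_sub al (mnm1 i).
have alE : al = mnm_add be (mnm1 i).
  apply/mnmP => l; rewrite mnmDE mnmBE mnm1E.
  by case: eqP => [<-|_]; rewrite ?addn0 ?subn0 // subnK.
have bej : mpoly.mdeg be = j by apply/eqP; rewrite -eqSS -alj alE mdegD mdeg1 addn1.
have bek : (mpoly.mdeg be <= k - c0)%N by apply: leq_trans alk; rewrite alj bej.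
apply: le_trans (IHj be bej bek).
have := zs be be bek bek; rewrite -pairing_loc_entry /sphere_poly mulrBr mulr1.
rewrite -scaleN1r pairingD pairingZ mulN1r -mpolyXD pairingX mulr_sumr pairing_sum.
move=> /eqP; rewrite subr_eq0 => /eqP <-; rewrite (bigD1 i) //=.
have term l : pairing (mpolyX R (mnm_add be be) * mpolyX R (mnm1 l) ^+ 2) z =
    z (mnm_add (mnm_add be (mnm1 l)) (mnm_add be (mnm1 l))).
  rewrite expr2 -!mpolyXD pairingX; congr (z _).
  by apply/mnmP => x; rewrite !mnmDE addnACA.
rewrite term -alE lerDl; apply: sumr_ge0 => l _; rewrite term; apply: zpos.
rewrite mdegD mdeg1 addn1 bej -alj; exact: leq_trans alk (leq_subr _ _).
Qed.

(** Positivity on the squares of [1 + x^al] and [1 - x^al] gives [2 |z_al| <= z_0 + z_(2 al)], and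
    the even moment is at most [z_0]. *)
Lemma moment_bound k (z : mvec) al : loc_psd k 1 z -> loc_zero k sphere_poly z ->
  (mpoly.mdeg al <= k - c0)%N -> `|z al| <= z (@mnm0 n).
Proof.
move=> z1 zs alk; have al2 := even_moment_bound z1 zs alk.
have sq (e : R) : e ^+ 2 = 1 -> 0 <= z (@mnm0 n) + 2 * (e * z al) + z (mnm_add al al).
  move=> e2; have := loc_psd1_pairing (q := 1 + e *: mpolyX R al) _ z1.
  have -> : (1 + e *: mpolyX R al) ^+ 2 =
      mpolyX R (@mnm0 n) + (2 * e) *: mpolyX R al + mpolyX R (mnm_add al al).
    rewrite mpolyX0 mpolyXD -!mul_mpolyC.
    have c2 : e%:MP_[n] ^+ 2 = 1 :> poly by rewrite -rmorphXn /= e2 mpolyC1.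
    transitivity (1 + 2 * e%:MP_[n] * mpolyX R al + e%:MP_[n] ^+ 2 * (mpolyX R al * mpolyX R al)).
      by ring.
    by rewrite c2 mul1r mpolyCM mpolyC_nat.
  rewrite !pairingD pairingZ !pairingX -mulrA; apply.
  apply: leq_trans (msizeD_le _ _) _; rewrite geq_max msize1 ltnS leq0n /=.
  apply: leq_trans (msizeZ_le _ _) _; rewrite msizeX ltnS.
  exact: leq_trans alk (leq_subr _ _).
have h1 := sq 1 (expr1n _ _); have h2 := sq (-1) (etrans (sqrrN _) (expr1n _ _)).
by rewrite ler_norml; apply/andP; split; lra.
Qed.

(** * Limits of feasible points of relaxations of growing order *)

Section Limit.
Variables (cE cI : seq poly) (U : set_system nat).
Hypotheses (UU : UltraFilter U) (Uoo : \oo `<=` U).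
Variables (kk : nat -> nat) (y : nat -> mvec) (z : mvec).
Hypothesis kkP : forall i, (i <= kk i)%N.
Hypothesis yE : forall i c, c \in cE -> loc_zero (kk i) (hom_part c) (y i).
Hypothesis yI : forall i c, c \in cI -> loc_psd (kk i) (hom_part c) (y i).
Hypothesis ys : forall i, loc_zero (kk i) sphere_poly (y i).
Hypothesis y1 : forall i, loc_psd (kk i) 1 (y i).
Hypothesis yz : forall al, (fun i => y i al) @ U --> z al.

Let Uge K : U [set i | (K <= i)%N].
Proof. by apply: Uoo; exact: nbhs_infty_ge. Qed.

Lemma pairing_cvg (p : poly) : (fun i => pairing p (y i)) @ U --> pairing p z.
Proof. by apply: cvg_sumr => al; apply: cvgM; [exact: cvg_cst|exact: yz]. Qed.

Let large_loc_size (q g : poly) i : (msize q + uphalf (pdeg g) <= i)%N ->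
  (msize q <= (loc_size (kk i) g).+1)%N.
Proof.
move=> h; apply: leqW; rewrite /loc_size leq_subRL.
  by rewrite addnC; exact: leq_trans h (kkP i).
by apply: leq_trans (leq_addl _ _) (leq_trans h (kkP i)).
Qed.

(** A fixed multiplier [q] fits into the localizing matrix of order [kk i] for all large [i], so the
    inequality passes to the limit. *)
Let limit_square_positive g : (forall i, loc_psd (kk i) g (y i)) ->
  square_positive (fun p => pairing p z) g.
Proof.
move=> yg q; apply: cvgr_to_ge (@pairing_cvg (q ^+ 2 * g)) _.
apply: filterS (Uge (msize q + uphalf (pdeg g))) => i /= hi.
exact: loc_psd_pairing (large_loc_size hi) (yg i).
Qed.

Let limit_ideal_null e : (forall i, loc_zero (kk i) e (y i)) ->
  ideal_null (fun p => pairing p z) e.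
Proof.
move=> ye q; have ev0 : U [set i | pairing (q * e) (y i) = 0].
  apply: filterS (Uge (msize q + uphalf (pdeg e))) => i /= hi.
  exact: loc_zero_pairing (large_loc_size hi) (ye i).
apply/eqP; rewrite eq_le; apply/andP; split.
  by apply: cvgr_to_le (@pairing_cvg (q * e)) _; apply: filterS ev0 => i /= ->.
by apply: cvgr_to_ge (@pairing_cvg (q * e)) _; apply: filterS ev0 => i /= ->.
Qed.

Lemma limit_positive (f : poly) : (forall u, Kcirc cE cI u -> 0 < peval f u) ->
  0 <= pairing f z.
Proof.
move=> fpos; apply: (@putinar_functional R n (fun p => pairing p z)
    [seq hom_part c | c <- cE] [seq hom_part c | c <- cI]).
- exact: pairingD.
- exact: pairingZ.
- exact: limit_square_positive.
- exact: limit_ideal_null.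
- by move=> _ /mapP[c cE' ->]; apply: limit_ideal_null => i; exact: yE.
- by move=> _ /mapP[c cI' ->]; apply: limit_square_positive => i; exact: yI.
- move=> u uE uI us; apply: fpos; split; [|split=> //].
    by move=> c cE'; apply: uE; exact: map_f.
  by move=> c cI'; apply: uI; exact: map_f.
Qed.

(** A separating polynomial would be nonnegative on the compact set, whereas [limit_positive] asks
    for strict positivity; a small positive constant is added and then sent to 0. *)
Lemma limit_in_cone t : in_cone (@moment_curve R n t (Kcirc cE cI)) (truncate (t := t) z).
Proof.
apply: contrapT => nz.
have cK := @moment_curve_ultracompact R n t cE cI U UU.
have [p pK] := cone_separation UU Uoo cK ltr01 (@unit_dir_curve R n t (Kcirc cE cI)) nz.
apply/negP; rewrite -leNgt.
pose P : poly := \sum_(b : bmultinom n t.+1) p b *: mpolyX R b.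
have PE (w : mvec) : pairing P w = dot p (truncate w).
  by rewrite pairing_sum; apply: eq_bigr => b _; rewrite pairingZ pairingX.
have Pu u : peval P u = dot p (moment_vector u).
  rewrite /peval /P raddf_sum; apply: eq_bigr => b _ /=.
  by rewrite mevalZ mevalX.
have z0 : 0 <= z (@mnm0 n).
  rewrite -pairingX mpolyX0; apply: limit_positive => u _.
  by rewrite /peval meval1.
rewrite -PE; apply/ler_addgt0Pr => e e0.
(* Dividing by [z_0 + 1] keeps the contribution of the constant to the pairing below [e]. *)
have e1 : 0 < e / (z (@mnm0 n) + 1) by rewrite divr_gt0 // ltr_wpDl.
have := @limit_positive (P + (e / (z (@mnm0 n) + 1)) *: 1).
rewrite pairingD pairingZ -mpolyX0 pairingX => H.
have {}H : 0 <= pairing P z + e / (z (@mnm0 n) + 1) * z (@mnm0 n).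
  apply: H => u Ku; rewrite /peval mevalD mevalZ mpolyX0 meval1 mulr1 -/(peval P u) Pu.
  by rewrite ltr_wpDl //; apply: pK; exists u.
apply: le_trans H _; rewrite lerD2l mulrAC ler_pdivrMr ?ltr_wpDl //.
by rewrite ler_wpM2l ?ltW // ltrDl.
Qed.

End Limit.

End Relaxation.

(** * Bounds and accumulation points of minimizers of the relaxations *)

Section Convergence.
Context {R : realType} {n : nat}.
Local Notation poly := (mpoly n R).
Local Notation pt := (n.-tuple R).
Local Notation mvec := (@mvec R n).

(** Subtracting a small constant stays within the ball around [p], hence in the SOS cone; half the
    radius meets the strict inequality. *)
Lemma sos_interior_margin t (p : poly) : sos_interior t p ->
  exists2 e : R, 0 < e & exists s : seq poly, p = e *: 1 + \sum_(h <- s) h ^+ 2.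
Proof.
move=> [pt [e e0 H]]; exists (e / 2); first by rewrite divr_gt0.
have [|al _|_ [s sE]] := H (p - (e / 2) *: 1).
- rewrite /pdeg; apply/bigmax_leqP_seq => m; rewrite mcoeff_msupp mcoeffB mcoeffZ mcoeff1 => pm _.
  have [->|m0] := eqVneq m (@mnm0 n); first by rewrite mdeg0.
  rewrite (negPf m0) mulr0 subr0 -mcoeff_msupp in pm; apply: leq_trans pt.
  exact: (@leq_bigmax_seq _ (msupp p) xpredT (@mpoly.mdeg n) _ pm).
- rewrite mcoeffB mcoeffZ mcoeff1 addrAC subrr add0r normrN normrM.
  rewrite gtr0_norm ?divr_gt0 //; case: (_ == _); rewrite ?normr1 ?normr0; lra.
by exists s; rewrite -sE addrC subrK.
Qed.

Lemma interior_pairing_bound (e : R) (s : seq poly) k (z : mvec) :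
  (forall h, h \in s -> (msize h <= k.+1)%N) -> loc_psd k 1 z ->
  e * z (@mnm0 n) <= pairing (e *: 1 + \sum_(h <- s) h ^+ 2) z.
Proof.
move=> sk z1; rewrite pairingD pairingZ -mpolyX0 pairingX lerDl pairing_sum.
by rewrite big_seq; apply: sumr_ge0 => h /sk hk; exact: loc_psd1_pairing hk z1.
Qed.

Variables (cE cI : seq poly) (m : nat) (g : 'I_m -> poly) (a : 'I_m -> R).
Variables (k0 : nat) (zk : nat -> mvec) (Rp : poly) (v e : R) (s : seq poly).
Hypothesis e0 : 0 < e.
Hypothesis RpE : Rp = e *: 1 + \sum_(h <- s) h ^+ 2.
Hypothesis zkf : forall k, (k0 <= k)%N -> sdp_feasible cE cI g a k (zk k).
Hypothesis zkv : forall k, (k0 <= k)%N -> pairing Rp (zk k) <= v.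

Let c0 := uphalf (pdeg (@sphere_poly R n)).
Let K0 := (\max_(h <- s) msize h)%N.

Lemma sdp_moment_bound k al : (k0 <= k)%N -> (K0 <= k)%N -> (mpoly.mdeg al + c0 <= k)%N ->
  `|zk k al| <= v / e.
Proof.
move=> k0k K0k alk; have [_ [_ [_ [zs z1]]]] := zkf k0k.
apply: le_trans (moment_bound z1 zs _) _.
  by rewrite leq_subRL ?(leq_trans (leq_addl _ _) alk) // addnC.
rewrite ler_pdivlMr // mulrC; apply: le_trans (zkv k0k); rewrite RpE.
apply: interior_pairing_bound => // h hs; apply: leqW; apply: leq_trans K0k.
exact: (@leq_bigmax_seq _ s xpredT (fun h : poly => msize h) _ hs).
Qed.

Lemma sdp_sequence_bounded t : exists B : R, forall k, (k0 <= k)%N ->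
  forall al, (mpoly.mdeg al <= t)%N -> `|zk k al| <= B.
Proof.
pose K1 := maxn K0 (t + c0).
(* The moment bound is available from order [K1] on; the finitely many earlier vectors are bounded
   by the sum of their entries. *)
pose B1 := \sum_(k < K1) \sum_(b : bmultinom n t.+1) `|zk k b|.
have B10 : 0 <= B1 by apply: sumr_ge0 => k _; exact: sumr_ge0.
exists (`|v / e| + B1) => k k0k al alt; have [K1k|kK1] := leqP K1 k.
  apply: le_trans (sdp_moment_bound k0k _ _) _.
  - by apply: leq_trans K1k; exact: leq_maxl.
  - by apply: leq_trans K1k; apply: leq_trans (leq_maxr _ _); rewrite leq_add2r.
  - by apply: le_trans (ler_norm _) _; rewrite lerDl.
have [b <-] := bmultinom_of alt; apply: ler_wpDl => //.
rewrite /B1 (bigD1 (Ordinal kK1)) //= (bigD1 b) //= -addrA lerDl.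
by rewrite addr_ge0 //; apply: sumr_ge0 => // ? _; exact: sumr_ge0.
Qed.

(** An accumulation point only concerns degrees up to [tt]. Along orders that approach it, the
    ultralimit of all moments extends it to a full vector, to which [limit_in_cone] applies. *)
Lemma sdp_accumulation t tt (zz : mvec) : accum_point tt k0 zk zz ->
  exists z : mvec, [/\ in_cone (@moment_curve R n t (Kcirc cE cI)) (truncate (t := t) z),
    forall i, pairing (g i) z <= a i, pairing Rp z <= v
    & forall al, (mpoly.mdeg al <= tt)%N -> z al = zz al].
Proof.
move=> acc; have [U [UU Uoo]] := free_ultrafilter.
have /choice[kk kkP] : forall i : nat, exists k, [/\ (i <= k)%N, (k0 <= k)%N
    & forall al, (mpoly.mdeg al <= tt)%N -> `|zk k al - zz al| < i.+1%:R^-1].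
  move=> i; have i0 : 0 < i.+1%:R^-1 :> R by rewrite invr_gt0 ltr0n.
  by have [k [ik [k0k kz]]] := acc _ i0 i; exists k.
have ikk i : (i <= kk i)%N by have [] := kkP i.
have k0kk i : (k0 <= kk i)%N by have [] := kkP i.
have /choice[z zP] : forall al, exists l : R, (fun i => zk (kk i) al) @ U --> l.
  move=> al; apply: (@ultra_bounded_cvg _ _ _ _ _ (v / e)).
  have : U [set i | (maxn K0 (mpoly.mdeg al + c0) <= i)%N] by apply: Uoo; exact: nbhs_infty_ge.
  apply: filterS => i /=; rewrite geq_max => /andP[h1 h2].
  by apply: sdp_moment_bound => //; exact: leq_trans (ikk i).
have zkcvg p : (fun i => pairing p (zk (kk i))) @ U --> pairing p z.
  exact: pairing_cvg.
exists z; split.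
- apply: (@limit_in_cone R n cE cI U UU Uoo kk (fun i => zk (kk i)) z) => //.
  + by move=> i c cc; have [_ [H _]] := zkf (k0kk i); exact: H.
  + by move=> i c cc; have [_ [_ [H _]]] := zkf (k0kk i); exact: H.
  + by move=> i; have [_ [_ [_ [H _]]]] := zkf (k0kk i).
  + by move=> i; have [_ [_ [_ [_ H]]]] := zkf (k0kk i).
- move=> i; apply: cvgr_to_le (zkcvg (g i)) _.
  by apply: filterE => j /=; have [] := zkf (k0kk j).
- by apply: cvgr_to_le (zkcvg Rp) _; apply: filterE => j /=; exact: zkv.
- move=> al altt; apply/eqP; rewrite -subr_eq0 -normr_le0.
  have inv0 : (fun k : nat => k.+1%:R^-1 : R) @ U --> (0 : R) by exact: cvg_free_inv.
  have dcvg : (fun i => `|zk (kk i) al - zz al|) @ U --> `|z al - zz al|.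
    by apply: cvg_norm; apply: cvgB; [exact: zP|exact: cvg_cst].
  apply: (ler_cvg_to dcvg inv0).
  by apply: filterE => i /=; have [_ _ /(_ al altt) /ltW] := kkP i.
Qed.

End Convergence.

(** * Generic uniqueness and convergence of the relaxations *)

Theorem theorem4p4 (R : realType) (n : nat)
    (cE cI : seq (mpoly.mpoly n R))           (* c_i, i in E ; c_j, j in I *)
    (d m : nat) (g : 'I_m -> mpoly.mpoly n R) (a : 'I_m -> R) :
  (forall i, (pdeg (g i) <= d)%N) ->
  (exists z : mvec, in_Rt d (Kcirc cE cI) z /\ forall i, pairing (g i) z <= a i) ->
  let d1 := uphalf d in
  let d2 := maxn d1 (dc cE cI) in
  exists N : set (mpoly.mpoly n R), coef_null d1.*2 N /\
  forall Rp : mpoly.mpoly n R, sos_interior d1.*2 Rp -> ~ N Rp ->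
  exists zs : mvec,
    (* (i) zs is a minimizer of the moment problem ... *)
    (in_Rt d1.*2 (Kcirc cE cI) zs /\ (forall i, pairing (g i) zs <= a i) /\
     (forall z : mvec, in_Rt d1.*2 (Kcirc cE cI) z ->
        (forall i, pairing (g i) z <= a i) -> pairing Rp zs <= pairing Rp z)) /\
    (* ... it is the unique one (as an element of R^{N^n_{2 d1}}) ... *)
    (forall z : mvec, in_Rt d1.*2 (Kcirc cE cI) z ->
        (forall i, pairing (g i) z <= a i) -> pairing Rp z = pairing Rp zs ->
        trunc_eq d1.*2 z zs) /\
    (* ... and it is an r-atomic combination with r <= m *)
    (exists (r : nat) (lam : 'I_r -> R) (u : 'I_r -> n.-tuple R),
        (r <= m)%N /\ (forall j, 0 < lam j) /\ injective u /\
        (forall j, Kcirc cE cI (u j)) /\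
        forall al, (mdeg al <= d1.*2)%N ->
          zs al = \sum_(j < r) lam j * mono_eval al (u j)) /\
    (* (ii) any sequence of minimizers of the SDP relaxations *)
    (forall zk : nat -> mvec,
      (forall k, (d2 <= k)%N ->
         sdp_feasible cE cI g a k (zk k) /\
         forall z : mvec, sdp_feasible cE cI g a k z -> pairing Rp (zk k) <= pairing Rp z) ->
      forall t, (d1 <= t)%N ->
        (exists B : R, forall k, (d2 <= k)%N ->
           forall al, (mdeg al <= t.*2)%N -> `|zk k al| <= B) /\
        (forall zz : mvec, accum_point t.*2 d2 zk zz -> trunc_eq d1.*2 zz zs)).
Proof.
move=> gd [z0 [z0R z0a]] d1 d2.
pose t := d1.*2; pose K := Kcirc cE cI.
pose X := @moment_curve R n t K.
have dt : (d <= t)%N by rewrite /t /d1 uphalf_half doubleD -{1}(odd_double_half d) leq_add2r; case: odd.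
have gt i : (pdeg (g i) <= t)%N := leq_trans (gd i) dt.
pose G i := coefs (t := t) (g i).
have gG i z : pairing (g i) z = dot (G i) (truncate z) := pairing_dot z (gt i).
pose A := minimizer X G a.
exists [set p | exists s s', [/\ A (coefs p) s, A (coefs p) s' & s <> s']]; split.
  apply: (box_null_coef_null (S := [set x | exists s s', [/\ A x s, A x s' & s <> s']])).
  apply: (@monotone_multivalued_null _ _ (bmnm0 t)) => x y s s' [fs xs] [fs' ys'].
  (* Optimality of [s] for [x] and of [s'] for [y], added up, is the monotonicity of the minimizer
     map. *)
  rewrite (_ : \sum_b _ = (dot x s - dot x s') + (dot y s' - dot y s)).
    by have := xs _ fs'; have := ys' _ fs; lra.
  by rewrite /dot -!sumrB -big_split; apply: eq_bigr => b _ /=; ring.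
move=> Rp Rint nN; pose rho := coefs (t := t) Rp.
have Rt : (pdeg Rp <= t)%N by have [] := Rint.
have Rrho z : pairing Rp z = dot rho (truncate z) := pairing_dot z Rt.
have [e e0 [s RpE]] := sos_interior_margin Rint.
have rhoX x : X x -> e <= dot rho x.
  move=> [u _ <-]; rewrite peval_dot // RpE /peval mevalD mevalZ meval1 mulr1 lerDl.
  by rewrite raddf_sum; apply: sumr_ge0 => h _ /=; rewrite rmorphXn sqr_ge0.
(* The given point has meaningful moments only up to degree [d]; an atomic representation supplies
   those up to [2 d1] without changing the constraint values. *)
have f0 : feasible X G a !=set0.
  have [r [lam [u [lam0 Ku z0E]]]] := in_cone_atomic (in_Rt_cone z0R).
  exists (truncate (atomic lam u)); split; first exact: atomic_in_cone.
  move=> i; rewrite -gG; apply: le_trans (z0a i).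
  by rewrite !(pairing_dot _ (gd i)) z0E.
have [U [UU Uoo]] := free_ultrafilter.
have cX : ultracompact U X := moment_curve_ultracompact UU.
have [s0 s0min] := minimizer_exists UU Uoo cX e0 rhoX f0.
have s0uniq y : A rho y -> y = s0.
  by move=> ymin; apply: contrapT => ys0; apply: nN; exists y, s0.
have [r [lam [x [rm [lam0 Xx xinj s0E]]]]] := unique_minimizer_atoms s0min s0uniq.
have /choice[u uP] : forall j, exists u, K u /\ moment_vector (t := t) u = x j.
  by move=> j; have [u Ku ux] := Xx j; exists u.
have Ku j : K (u j) by have [] := uP j.
pose zs := atomic lam u.
have zsE : truncate (t := t) zs = s0.
  by apply: funext => b; rewrite s0E; apply: eq_bigr => j _; rewrite -(uP j).2.
have [[s0c s0a] s0m] := s0min.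
have lamw j : 0 <= lam j := ltW (lam0 j).
have zsa i : pairing (g i) zs <= a i by rewrite gG zsE.
have trunc (z : @mvec R n) : truncate (t := t) z = s0 -> trunc_eq t z zs.
  move=> zs0 al alt; have [b <-] := bmultinom_of alt.
  by have := congr1 (fun f => f b) (etrans zs0 (esym zsE)).
have Rtfeas z : in_Rt t K z -> (forall i, pairing (g i) z <= a i) ->
    feasible X G a (truncate z).
  by move=> zR za; split; [exact: in_Rt_cone|move=> i; rewrite -gG].
exists zs; split; [|split; [|split]].
- split; first by apply: cone_in_Rt; rewrite zsE.
  split=> // z zR za; rewrite !Rrho zsE; apply: s0m; exact: Rtfeas.
- move=> z zR za zv; apply: trunc; apply: s0uniq; split; first exact: Rtfeas.
  by move=> y /s0m; rewrite -Rrho zv Rrho zsE.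
- exists r, lam, u; split=> //; split=> //; split=> // i j uij.
  by apply: xinj; rewrite -(uP i).2 -(uP j).2 uij.
move=> zk zkmin t' d1t'.
have zkf k : (d2 <= k)%N -> sdp_feasible cE cI g a k (zk k) by move=> /zkmin[].
(* The atomic minimizer is feasible for every relaxation, so its value bounds all relaxed optima
   from above. *)
have zkv k : (d2 <= k)%N -> pairing Rp (zk k) <= pairing Rp zs.
  by move=> /zkmin[_]; apply; exact: atomic_sdp_feasible.
split; first exact: sdp_sequence_bounded e0 RpE zkf zkv _.
move=> zz acc.
have [z [zc za zv zzE]] := sdp_accumulation e0 RpE zkf zkv t acc.
(* The limit lies in the cone, satisfies the constraints and has value at most the optimum, so it is
   the unique minimizer. *)
have zs0 : truncate (t := t) z = s0.
  apply: s0uniq; split; first by split=> // i; rewrite -gG.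
  by move=> y /s0m; apply: le_trans; rewrite -Rrho -zsE -Rrho.
move=> al alt; rewrite -zzE; first exact: trunc.
by apply: leq_trans alt _; rewrite leq_double.
Qed.
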